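(* Let $\mathcal{M}$ be an $o$-minimal expansion of a real closed field. Then any formula $\varphi(x;y)$ with $|x|=2$ admits a distal cell decomposition $\mathcal{T}$ with $|\mathcal{T}(S)|=O(|S|^2)$, i.e. there is a constant $C$ such that $|\mathcal{T}(S)|\le C|S|^2$ for all non-empty finite $S\subseteq M^{|y|}$.
   Context: For $A,X\subseteq M^{m}$, $A$ crosses $X$ if both $X\cap A$ and $X\setminus A$ are non-empty. A distal cell decomposition for $\{\varphi(x;y)\}$ is an assignment $\mathcal{T}$ to each finite $S\subseteq M^{|y|}$ of a family $\mathcal{T}(S)$ of subsets of $M^{|x|}$ covering $M^{|x|}$, none of which is crossed by any $\varphi(M;s)=\{a:\mathcal{M}\models\varphi(a;s)\}$ with $s\in S$, such that there exist a finite set of formulas $\Psi(x;y_1,\dots,y_k)$ ($|y_i|=|y|$) and for each $\psi\in\Psi$ a formula $\theta_\psi(y;y_1,\dots,y_k)$ with: whenever $\Delta=\psi(M;s_1,\dots,s_k)$ the set $\mathcal{I}(\Delta):=\theta_\psi(M;s_1,\dots,s_k)$ depends only on $\Delta$, and for every finite $S$, $\mathcal{T}(S)=\{\Delta\in\Psi(S):\mathcal{I}(\Delta)\cap S=\emptyset\}$, where $\Psi(S)$ is the family of all sets $\psi(M;s_1,\dots,s_k)$ with $\psi\in\Psi$, $s_i\in S$.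
   Formalization: The family T(S) is required to cover M^{|x|} only for non-empty finite S: for S empty and k ≥ 1 the family Ψ(S) is empty and cannot cover, and k = 0 does not suffice for a formula such as x_1 < y; the other clauses are kept for all finite S. *)

(* Defs.v *)
From HB Require Import structures.
From mathcomp Require Import all_boot all_order all_algebra finmap.
From mathcomp Require Import boolp classical_sets functions cardinality.

Set Implicit Arguments.
Unset Strict Implicit.
Unset Printing Implicit Defensive.

Import Order.TTheory GRing.Theory Num.Theory.

Local Open Scope classical_set_scope.
Local Open Scope ring_scope.

(* [fsym n] and [rsym n] are the function and relation symbols of arity [n];  *)
(* constants are the function symbols of arity 0.                             *)
Record language := Language { fsym : nat -> Type; rsym : nat -> Type }.

Inductive term (L : language) (V : Type) : Type :=
| Var of V
| App (n : nat) of fsym L n & ('I_n -> term L V).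

(* [formula L V] is the type of first-order L-formulas, without parameters,   *)
(* whose free variables are in [V]. A quantifier binds the variable [None].   *)
Inductive formula (L : language) (V : Type) : Type :=
| Bot
| Eq of term L V & term L V
| Rel (n : nat) of rsym L n & ('I_n -> term L V)
| Not of formula L V
| And of formula L V & formula L V
| Or of formula L V & formula L V
| Imp of formula L V & formula L V
| Exists of formula L (option V)
| Forall of formula L (option V).

Record structure (L : language) (M : Type) := Structure {
  fint : forall n, fsym L n -> {ffun 'I_n -> M} -> M;
  rint : forall n, rsym L n -> set {ffun 'I_n -> M} }.

Section Semantics.
Variables (L : language) (M : Type) (A : structure L M).

Fixpoint eval (V : Type) (e : V -> M) (t : term L V) : M :=
  match t with
  | Var v => e v
  | App n f ts => fint A f [ffun i => eval e (ts i)]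
  end.

Fixpoint holds (V : Type) (e : V -> M) (f : formula L V) : Prop :=
  match f with
  | Bot => False
  | Eq t u => eval e t = eval e u
  | Rel n r ts => rint A r [ffun i => eval e (ts i)]
  | Not g => ~ holds e g
  | And g h => holds e g /\ holds e h
  | Or g h => holds e g \/ holds e h
  | Imp g h => holds e g -> holds e h
  | Exists g => exists a : M, holds (oapp e a) g
  | Forall g => forall a : M, holds (oapp e a) g
  end.

(* The set f(M; b) of a partitioned formula f(x; y), where |x| = m and the    *)
(* variables of y are indexed by W.                                           *)
Definition defset (m : nat) (W : Type) (f : formula L ('I_m + W))
    (b : W -> M) : set {ffun 'I_m -> M} :=
  [set a | holds (fun v => match v with inl i => a i | inr w => b w end) f].

End Semantics.

(* The language contains symbols for 0, 1, -, +, *, < which are interpreted   *)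
(* by the ordered field structure of R.                                       *)
Definition expands_ordered_field (L : language) (R : rcfType)
    (A : structure L R) : Prop :=
  [/\ exists c : fsym L 0, forall x, fint A c x = 0,
      exists c : fsym L 0, forall x, fint A c x = 1 &
  [/\ exists f : fsym L 1, forall x, fint A f x = - x ord0,
      exists f : fsym L 2, forall x, fint A f x = x ord0 + x ord_max,
      exists f : fsym L 2, forall x, fint A f x = x ord0 * x ord_max &
      exists r : rsym L 2, forall x, rint A r x <-> x ord0 < x ord_max]].

(* Points are the intervals `[a, a]; endpoints lie in R or are infinite.      *)
Definition o_minimal (L : language) (R : rcfType) (A : structure L R) : Prop :=
  forall (p : nat) (f : formula L ('I_1 + 'I_p)) (b : {ffun 'I_p -> R}),
  exists s : seq (interval R),
    [set a : R | defset A f b [ffun=> a]] =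
    [set a : R | has (fun i => a \in i) s].

Definition crosses (T : Type) (A X : set T) : Prop :=
  X `&` A !=set0 /\ X `\` A !=set0.

Section DistalCellDecomposition.
Variables (L : language) (M : choiceType) (A : structure L M) (m n : nat).

(* A tuple (s_1, ..., s_k) of elements of M^n, as an assignment of the        *)
(* variables (y_1, ..., y_k).                                                 *)
Definition tuple_env (k : nat) (s : 'I_k -> {ffun 'I_n -> M})
    (p : 'I_k * 'I_n) : M :=
  s p.1 p.2.

(* The family Psi(S), where Psi = {psi_i : i < N}.                            *)
Definition instances (k N : nat)
    (psi : 'I_N -> formula L ('I_m + 'I_k * 'I_n))
    (S : {fset {ffun 'I_n -> M}}) :
    set (set {ffun 'I_m -> M}) :=
  [set D | exists (i : 'I_N) (s : 'I_k -> {ffun 'I_n -> M}),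
     (forall j, s j \in S) /\ D = defset A (psi i) (tuple_env s)].

(* Covering is only required for non-empty S: for empty S and k > 0 the       *)
(* family Psi(S) is empty. That the set theta_i(M; s) depends only on         *)
(* D = psi_i(M; s) is expressed by the existence of the function I.           *)
Definition distal_cell_decomposition (phi : formula L ('I_m + 'I_n))
    (T : {fset {ffun 'I_n -> M}} -> set (set {ffun 'I_m -> M})) : Prop :=
  (forall S : {fset {ffun 'I_n -> M}}, S != fset0 -> \bigcup_(D in T S) D = setT) /\
  (forall S D (s : {ffun 'I_n -> M}), T S D -> s \in S ->
     ~ crosses (defset A phi s) D) /\
  exists (k N : nat) (psi : 'I_N -> formula L ('I_m + 'I_k * 'I_n))
         (theta : 'I_N -> formula L ('I_n + 'I_k * 'I_n))
         (I : set {ffun 'I_m -> M} -> set {ffun 'I_n -> M}),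
    (forall i (s : 'I_k -> {ffun 'I_n -> M}),
       I (defset A (psi i) (tuple_env s)) =
       defset A (theta i) (tuple_env s)) /\
    (forall S, T S = [set D | instances psi S D /\ I D `&` [set` S] = set0]).

End DistalCellDecomposition.

(* Main.v *)
Require Import Defs.
From mathcomp Require Import all_boot all_order all_algebra finmap.
From mathcomp Require Import boolp classical_sets functions cardinality filter.

(* Uniform finiteness. In an o-minimal structure a definable function is
   continuous off a finite set, hence the number of breakpoints of the members
   of a one-parameter definable family of subsets of the line is bounded. For
   more parameters one inducts: if no bound held, then some ultrafilter U on the
   line would contain, for every N, the set of the values of the first parameter
   for which N is exceeded; the germs of definable functions modulo U form again
   an o-minimal structure (by the one-parameter case), and the family, with its
   first parameter replaced by the germ of the identity, contradicts the
   induction hypothesis there.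

   Decomposition. The fibers of phi(x1, x2; s) over x1 are governed by boundedly
   many curves x2 = f(x1; s). An event of a curve is a value of x1 at which its
   position with respect to another curve changes, or at which the shape of
   the fiber of some phi(x1, x2; s) changes; each pair of parameters contributes
   boundedly many events. A cell is bounded above and below by two consecutive
   curves, over a point or a maximal interval without events of these two curves.
   It is determined by one of the two curves together with an event of that
   curve at its left end, so that there are O(|S|) * O(|S|) cells. The condition
   that no s in S interferes with a cell Delta is a first-order property of Delta
   and s, hence it may serve as the definition of I(Delta). *)

Set Implicit Arguments.
Unset Strict Implicit.
Unset Printing Implicit Defensive.

(** * Finite predicates *)

(** The one-variable theory is applied to R, to reversed orders and to ultrapowers, whose definable
    sets do not come from formulas. Definability is therefore a class [D] closed under the
    first-order operations, on a dense order without end points. The field serves to construct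
    definable choice, which then is an axiom of [omin], passes to ultrapowers and gives the
    existential step of Łoś's theorem there. The one-variable theory names arbitrary points, but psi
    and theta must be free of parameters. So R carries two classes, [reals] without and [creals]
    with parameters; finiteness is proved for [creals] and read off for [reals], whose breakpoints
    are the same. A cell has four parameters, and counting these would give a fourth power. One side
    and one event determine it because curves of the family do not pass through a cell: of two cells
    that share a side over a point, neither can end before the other. *)

Fixpoint card_le (T : Type) (n : nat) (X : T -> Prop) : Prop :=
  if n is m.+1 then exists y, card_le m (fun x => X x /\ x <> y)
  else forall x, ~ X x.

Definition finite_pred (T : Type) (X : T -> Prop) := exists n, card_le n X.

Section FinitePredicates.
Variables (T : Type).
Implicit Types X Y : T -> Prop.

Lemma card_le_sub n X Y : (forall x, Y x -> X x) -> card_le n X -> card_le n Y.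
Proof.
elim: n X Y => [|n IH] X Y sYX /=; first by move=> X0 x /sYX/X0.
by case=> y Xy; exists y; apply: IH Xy => x [/sYX].
Qed.

Lemma card_leU n m X Y :
  card_le n X -> card_le m Y -> card_le (n + m) (fun x => X x \/ Y x).
Proof.
elim: n X => [|n IH] X /=.
  by move=> X0; apply: card_le_sub => x [/X0|].
case=> y Xy Ym; exists y; apply: card_le_sub (IH _ Xy Ym) => x [[Xx|Yx] xy]; [left|right] => //.
Qed.

(** [card_le] asks for a point to remove even when the predicate is empty; [x0] serves as that
    point. *)
Lemma card_le_weak (x0 : T) n m X : n <= m -> card_le n X -> card_le m X.
Proof.
move=> nm; rewrite -(subnKC nm).
suff Em k : card_le k (fun _ : T => False).
  by move=> /card_leU /(_ (Em (m - n))); apply: card_le_sub => x; left.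
by elim: k => [x []|k IH]; exists x0; apply: card_le_sub IH => x [].
Qed.

Lemma finite_sub X Y : (forall x, Y x -> X x) -> finite_pred X -> finite_pred Y.
Proof. by move=> sYX [n /(card_le_sub sYX)]; exists n. Qed.

Lemma finiteU X Y :
  finite_pred X -> finite_pred Y -> finite_pred (fun x => X x \/ Y x).
Proof. by move=> [n Xn] [m Ym]; exists (n + m); apply: card_leU. Qed.

Lemma finite_ind (P : (T -> Prop) -> Prop) :
    (forall X, (forall x, ~ X x) -> P X) ->
    (forall X y, X y -> P (fun x => X x /\ x <> y) -> P X) ->
  forall X, finite_pred X -> P X.
Proof.
move=> P0 PS X [n]; elim: n X => [|n IH] X /=; first exact: P0.
case=> y Xy.
have [XY|nXy] := pselect (X y); first by apply: (PS _ y) => //; apply: IH.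
apply: IH; apply: card_le_sub Xy => x Xx; split=> // xy.
by apply: nXy; rewrite -xy.
Qed.

(** The point removed by [card_le] may lie outside X; here it is exchanged for a given point of
    X. *)
Lemma card_leS_rem n X y :
  X y -> card_le n.+1 X <-> card_le n (fun x => X x /\ x <> y).
Proof.
move=> Xy; split; last by exists y.
elim: n X Xy => [|n IH] X Xy [z Xz].
  move=> x [Xx xy]; have := Xz x; have := Xz y.
  have [xz|xz] := pselect (x = z); last by move=> _ /(_ (conj Xx xz)).
  by move=> /(_ (conj Xy (fun yz => xy (etrans xz (esym yz))))).
have [->|yz] := pselect (y = z); first exact: Xz.
exists z; have /= := IH _ (conj Xy yz) Xz.
by apply: card_le_sub => x [[Xx xy] xz].
Qed.

End FinitePredicates.

(* [D] is the class of definable predicates in finitely many variables. *)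
Record dstr := Dstr {
  car :> Type;
  pt : car;
  lt : car -> car -> Prop;
  lt_irr : forall x, ~ lt x x;
  lt_trans : forall y x z, lt x y -> lt y z -> lt x z;
  lt_total : forall x y, lt x y \/ x = y \/ lt y x;
  dense : forall x y, lt x y -> exists z, lt x z /\ lt z y;
  unbounded_l : forall x, exists y, lt y x;
  unbounded_r : forall x, exists y, lt x y;
  D : forall W : finType, ((W -> car) -> Prop) -> Prop;
  D_and : forall (W : finType) (P Q : (W -> car) -> Prop),
    D P -> D Q -> D (fun e => P e /\ Q e);
  D_not : forall (W : finType) (P : (W -> car) -> Prop),
    D P -> D (fun e => ~ P e);
  D_exists : forall (W : finType) (P : (option W -> car) -> Prop),
    D P -> D (fun e => exists a, P (oapp e a));
  D_rename : forall (W W' : finType) (r : W -> W') (P : (W -> car) -> Prop),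
    D P -> D (fun e => P (fun w => e (r w)));
  D_lt2 : D (fun e : bool -> car => lt (e true) (e false));
  D_eq2 : D (fun e : bool -> car => e true = e false) }.

Arguments D {d W} P.
Notation "x ≺ y" := (lt x y) (at level 70).
Notation "x ≼ y" := (~ lt y x) (at level 70).

Ltac order_fact P pf :=
  lazymatch goal with
  | _ : P |- _ => fail
  | _ => let H := fresh "Hord" in have H : P := pf
  end.

(** * Dense linear orders, with a saturation tactic *)

Section Order.
Variable S : dstr.
Implicit Types x y z u v : S.

Lemma le_lt_trans y x z : x ≼ y -> y ≺ z -> x ≺ z.
Proof.
move=> xy yz; case: (lt_total x y) => [/lt_trans|[->|/xy]] //; exact.
Qed.

Lemma lt_le_trans y x z : x ≺ y -> y ≼ z -> x ≺ z.
Proof.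
by move=> xy yz; case: (lt_total y z) => [/(lt_trans xy)|[<-|/yz]].
Qed.

Lemma le_trans' y x z : x ≼ y -> y ≼ z -> x ≼ z.
Proof. by move=> xy yz zx; apply: yz; apply: lt_le_trans zx xy. Qed.

Lemma le_anti x y : x ≼ y -> y ≼ x -> x = y.
Proof. by move=> xy yx; case: (lt_total x y) => [/yx|[|/xy]]. Qed.

Lemma lt_leP x y : x ≺ y \/ y ≼ x. Proof. exact: EM. Qed.

End Order.

Ltac order_step :=
  match goal with
  | H1 : lt ?x ?y, H2 : lt ?y ?z |- _ =>
      order_fact (lt x z) (lt_trans H1 H2)
  | H1 : ~ lt ?y ?x, H2 : lt ?y ?z |- _ =>
      order_fact (lt x z) (le_lt_trans H1 H2)
  | H1 : lt ?x ?y, H2 : ~ lt ?z ?y |- _ =>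
      order_fact (lt x z) (lt_le_trans H1 H2)
  | H1 : ~ lt ?y ?x, H2 : ~ lt ?z ?y |- _ =>
      order_fact (~ lt z x) (le_trans' H1 H2)
  end.

Ltac order_close :=
  match goal with
  | H : lt ?x ?x |- _ => case: (lt_irr H)
  | H : lt ?x ?y, H' : ~ lt ?x ?y |- _ => case: (H' H)
  | H : ?x <> ?x |- _ => case: (H erefl)
  end.

Ltac order_prep :=
  repeat match goal with
  | H : _ /\ _ |- _ => case: H => ? ?
  | H : ?x = ?y |- _ => subst x || subst y
  end.

Ltac order_run := order_prep; repeat (first [order_close | order_step]).

Ltac order :=
  order_prep;
  lazymatch goal with
  | |- _ /\ _ => split; order
  | |- lt _ _ => apply: contrapT => ?; order_run
  | |- ~ _ => intro; order_run
  | |- _ = _ => apply: le_anti => ?; order_run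
  | |- _ => exfalso; order_run
  end.

Section OrderMore.
Variable S : dstr.
Implicit Types x y z u v : S.

Lemma between_max u u' x :
  u ≺ x -> u' ≺ x -> exists w, u ≺ w /\ u' ≺ w /\ w ≺ x.
Proof.
move=> ux u'x; case: (lt_leP u u') => uu'.
  by case: (dense u'x) => w ?; exists w; order.
by case: (dense ux) => w ?; exists w; order.
Qed.

Lemma between_min x u u' :
  x ≺ u -> x ≺ u' -> exists w, x ≺ w /\ w ≺ u /\ w ≺ u'.
Proof.
move=> ux u'x; case: (lt_leP u u') => uu'.
  by case: (dense ux) => w ?; exists w; order.
by case: (dense u'x) => w ?; exists w; order.
Qed.

Lemma finite_max (X : S -> Prop) :
  finite_pred X -> (exists x, X x) -> exists2 x, X x & forall y, X y -> y ≼ x.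
Proof.
elim/finite_ind => {X} [X X0 [x /X0]//|X y Xy IH _].
have [/IH [x [Xx xy] maxx]|nX] := pselect (exists x, X x /\ x <> y).
  case: (lt_leP x y) => xy'.
    exists y => // z Xz yz; have zy : z <> y by move=> zy; order.
    by have ? := maxx z (conj Xz zy); order.
  exists x => // z Xz; have [->|zy] := pselect (z = y) => //; exact: maxx z (conj Xz zy).
exists y => // z Xz; have [->|zy] := pselect (z = y); first exact: lt_irr.
by case: nX; exists z.
Qed.

Lemma finite_min (X : S -> Prop) :
  finite_pred X -> (exists x, X x) -> exists2 x, X x & forall y, X y -> x ≼ y.
Proof.
elim/finite_ind => {X} [X X0 [x /X0]//|X y Xy IH _].
have [/IH [x [Xx xy] maxx]|nX] := pselect (exists x, X x /\ x <> y).
  case: (lt_leP y x) => xy'.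
    exists y => // z Xz yz; have zy : z <> y by move=> zy; order.
    by have ? := maxx z (conj Xz zy); order.
  exists x => // z Xz; have [->|zy] := pselect (z = y) => //; exact: maxx z (conj Xz zy).
exists y => // z Xz; have [->|zy] := pselect (z = y); first exact: lt_irr.
by case: nX; exists z.
Qed.

Lemma finite_free_r (X : S -> Prop) a :
  finite_pred X -> exists2 v, a ≺ v & forall y, a ≺ y -> y ≺ v -> ~ X y.
Proof.
move=> Xfin.
have [Xa|Xa] := pselect (exists y, X y /\ a ≺ y).
  have Xfin' : finite_pred (fun y => X y /\ a ≺ y).
    by apply: finite_sub Xfin => y [].
  have [v [Xv av] minv] := finite_min Xfin' Xa.
  by exists v => // y ay yv Xy; apply: (minv y).
have [v av] := unbounded_r a; exists v => // y ay _ Xy.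
by apply: Xa; exists y.
Qed.

Lemma finite_free_l (X : S -> Prop) a :
  finite_pred X -> exists2 u, u ≺ a & forall y, u ≺ y -> y ≺ a -> ~ X y.
Proof.
move=> Xfin.
have [Xa|Xa] := pselect (exists y, X y /\ y ≺ a).
  have Xfin' : finite_pred (fun y => X y /\ y ≺ a).
    by apply: finite_sub Xfin => y [].
  have [v [Xv av] maxv] := finite_max Xfin' Xa.
  by exists v => // y ay yv Xy; apply: (maxv y).
have [v av] := unbounded_l a; exists v => // y ay ya Xy.
by apply: Xa; exists y.
Qed.

Lemma interval_infinite u v :
  u ≺ v -> finite_pred (fun x => u ≺ x /\ x ≺ v) -> False.
Proof.
move=> uv /finite_max; case.
  by have [w ?] := dense uv; exists w.
move=> x [ux xv] maxx; have [w [xw wv]] := dense xv.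
by apply: (maxx w) => //; order.
Qed.

End OrderMore.

(** * Definability *)

Section Definability.
Variable S : dstr.
Implicit Types W : finType.

Definition dfun W (t : (W -> S) -> S) :=
  D (fun e : option W -> S => e None = t (fun w => e (Some w))).

Definition D1 (P : S -> Prop) := D (fun e : unit -> S => P (e tt)).
Definition D2 (P : S -> S -> Prop) :=
  D (fun e : bool -> S => P (e true) (e false)).
Definition D3 (P : S -> S -> S -> Prop) :=
  D (fun e : option bool -> S => P (e None) (e (Some true)) (e (Some false))).
Definition dfun1 (f : S -> S) := D2 (fun y x => y = f x).

Lemma D_ext W (P Q : (W -> S) -> Prop) :
  (forall e, P e <-> Q e) -> D P -> D Q.
Proof. by move=> PQ; rewrite (_ : Q = P) //; apply/funext => e; apply/propext; split=> /PQ. Qed.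

Lemma D_or W (P Q : (W -> S) -> Prop) : D P -> D Q -> D (fun e => P e \/ Q e).
Proof.
move=> dP dQ; apply: D_ext (D_not (D_and (D_not dP) (D_not dQ))) => e.
by rewrite not_andE !notK.
Qed.

Lemma D_imp W (P Q : (W -> S) -> Prop) : D P -> D Q -> D (fun e => P e -> Q e).
Proof.
move=> dP dQ; apply: D_ext (D_not (D_and dP (D_not dQ))) => e.
by split=> [nPQ Pe|PQ [/PQ]//]; apply: contrapT => nQ; apply: nPQ.
Qed.

Lemma D_iff W (P Q : (W -> S) -> Prop) :
  D P -> D Q -> D (fun e => P e <-> Q e).
Proof. by move=> dP dQ; apply: D_and; apply: D_imp. Qed.

Lemma D_ex W (Q : (W -> S) -> S -> Prop) :
  D (fun e : option W -> S => Q (fun w => e (Some w)) (e None)) ->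
  D (fun e => exists a, Q e a).
Proof. exact: D_exists. Qed.

Lemma D_all W (Q : (W -> S) -> S -> Prop) :
  D (fun e : option W -> S => Q (fun w => e (Some w)) (e None)) ->
  D (fun e => forall a, Q e a).
Proof.
move=> dQ; apply: D_ext (D_not (D_ex (Q := fun e a => ~ Q e a) (D_not dQ))) => e.
by rewrite -forallNE; split=> Qe a; have := Qe a; rewrite notK.
Qed.

Lemma dfun_var W (w : W) : dfun (fun e => e w).
Proof.
by have := D_rename (fun b : bool => if b then None else Some w) (D_eq2 S).
Qed.

Lemma D_cst W (p : Prop) : D (fun _ : W -> S => p).
Proof.
have dT : D (fun _ : W -> S => True).
  apply: (D_ext _ (D_ex (Q := fun e a => a = a) _)) => [e|].
    by split=> // _; exists (pt S).
  exact: (D_rename (fun _ : bool => @None W) (D_eq2 S)).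
have [pT|pF] := pselect p; first by apply: D_ext dT.
by apply: D_ext (D_not dT) => e; split=> // H; case: H.
Qed.

Lemma D_subst1 W (P : (option W -> S) -> Prop) (t : (W -> S) -> S) :
  D P -> dfun t -> D (fun e => P (oapp e (t e))).
Proof.
move=> dP dt; apply: D_ext (D_exists (D_and dt dP)) => e.
by split=> [[a [/= <-]]|Pe] //; exists (t e).
Qed.

(** The variables of W are replaced one at a time inside W + W', where old and new variables cannot
    clash; the old ones are finally merged into a dummy variable and quantified away. *)
Lemma D_subst W W' (P : (W -> S) -> Prop) (t : W -> (W' -> S) -> S) :
  D P -> (forall w, dfun (t w)) -> D (fun e => P (fun w => t w e)).
Proof.
move=> dP dt.
have step (l : seq W) : D (fun e : W + W' -> S =>
    P (fun w => if w \in l then t w (fun v => e (inr v)) else e (inl w))).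
  elim: l => [|x l IH]; first by have := D_rename (@inl W W') dP.
  have [xl|xl] := boolP (x \in l).
    apply: D_ext IH => e; rewrite (_ : (fun _ => _) = (fun w => if w \in x :: l
      then t w (fun v => e (inr v)) else e (inl w))) //.
    by apply/funext => w; rewrite inE; case: eqP => // ->; rewrite xl.
  pose rho (v : W + W') := if v == inl x then None else Some v.
  have dt' : dfun (fun e : W + W' -> S => t x (fun v => e (inr v))).
    exact: (D_rename (omap (@inr W W')) (dt x)).
  have := D_subst1 (D_rename rho IH) dt'; apply: D_ext => e.
  rewrite (_ : (fun w => if w \in l then _ else _) = (fun w => if w \in x :: l
      then t w (fun v => e (inr v)) else e (inl w))) //.
  apply/funext => w; rewrite inE /rho; have [->|wx] := eqVneq w x.
    by rewrite (negPf xl) eqxx.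
  have /negPf -> : inl w != inl x :> W + W' by apply: contra_neq wx => -[].
  by [].
pose rho (v : W + W') := if v is inr v' then Some v' else None.
have := D_exists (D_rename rho (step (enum W))); apply: D_ext => e.
have E a : (fun w => if w \in enum W then t w (fun v => oapp e a (rho (inr v)))
    else oapp e a (rho (inl w))) = (fun w => t w e).
  by apply/funext => w; rewrite mem_enum.
by split=> [[a]|Pe]; [rewrite E|exists (pt S); rewrite E].
Qed.

Lemma dfun_weak W (t : (W -> S) -> S) :
  dfun t -> dfun (fun e : option W -> S => t (fun w => e (Some w))).
Proof. exact: (D_rename (omap (@Some W))). Qed.

Lemma D1_app W P (t : (W -> S) -> S) : D1 P -> dfun t -> D (fun e => P (t e)).
Proof. by move=> dP dt; apply: (D_subst (t := fun _ : unit => t) dP). Qed.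

Lemma D2_app W P (t1 t2 : (W -> S) -> S) :
  D2 P -> dfun t1 -> dfun t2 -> D (fun e => P (t1 e) (t2 e)).
Proof.
move=> dP dt1 dt2.
by apply: (D_subst (t := fun b : bool => if b then t1 else t2) dP); case.
Qed.

Lemma D3_app W P (t1 t2 t3 : (W -> S) -> S) :
  D3 P -> dfun t1 -> dfun t2 -> dfun t3 -> D (fun e => P (t1 e) (t2 e) (t3 e)).
Proof.
move=> dP dt1 dt2 dt3.
by apply: (D_subst (t := fun b : option bool =>
  if b is Some b then if b then t2 else t3 else t1) dP) => -[[]|].
Qed.

Lemma D_eq W (t1 t2 : (W -> S) -> S) :
  dfun t1 -> dfun t2 -> D (fun e => t1 e = t2 e).
Proof. exact: (D2_app (D_eq2 S)). Qed.

Lemma D_lt W (t1 t2 : (W -> S) -> S) :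
  dfun t1 -> dfun t2 -> D (fun e => t1 e ≺ t2 e).
Proof. exact: (D2_app (D_lt2 S)). Qed.

Lemma dfun_app W f (t : (W -> S) -> S) :
  dfun1 f -> dfun t -> dfun (fun e => f (t e)).
Proof. by move=> df /dfun_weak dt; apply: D2_app df (dfun_var _) dt. Qed.

Lemma D_all_fin W (I : finType) (P : I -> (W -> S) -> Prop) :
  (forall i, D (P i)) -> D (fun e => forall i, P i e).
Proof.
move=> dP; suff H (l : seq I) : D (fun e => forall i, i \in l -> P i e).
  by apply: D_ext (H (enum I)) => e; split=> He i *; apply: He; rewrite ?mem_enum.
elim: l => [|i l IH]; first by apply: D_ext (D_cst W True).
apply: D_ext (D_and (dP i) IH) => e; split=> [[Pi Pl] i'|He].
  by rewrite inE => /predU1P[->|/Pl].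
by split=> [|i' i'l]; apply: He; rewrite inE ?eqxx ?i'l ?orbT.
Qed.

(** The recursive form of [card_le] is a first-order statement for each fixed n; this makes it
    definable here and lets it pass to ultrapowers later. *)
Lemma D_card_le W (X : (W -> S) -> S -> Prop) n :
  D (fun e : option W -> S => X (fun w => e (Some w)) (e None)) ->
  D (fun e => card_le n (X e)).
Proof.
elim: n W X => [|n IH] W X dX /=; first exact: D_all (D_not dX).
apply: D_ex; apply: (IH _ (fun e x => X (fun w => e (Some w)) x /\ x <> e None)).
apply: D_and; last by apply: D_not; apply: D_eq; apply: dfun_var.
exact: (D_rename (omap (@Some W)) dX).
Qed.

Definition near (a : S) (P : S -> Prop) :=
  exists u v, u ≺ a /\ a ≺ v /\ forall t, u ≺ t -> t ≺ v -> P t.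

Definition bp (P : S -> Prop) (x : S) := ~ near x (fun y => P y <-> P x).

End Definability.

(* [bp P] is the set of breakpoints of [P]: [om_fin] and [om_const] together say
   that definable subsets of the line are finite unions of intervals. *)
Record omin (S : dstr) : Prop := Omin {
  om_cst : forall a : S, D1 (fun x => x = a);
  om_choice : forall (W : finType) (P : (option W -> S) -> Prop), D P ->
    exists2 F : (W -> S) -> S, dfun F &
      forall e, (exists a, P (oapp e a)) -> P (oapp e (F e));
  om_fin : forall P : S -> Prop, D1 P -> finite_pred (bp P);
  om_const : forall P : S -> Prop, D1 P -> forall x y, x ≺ y ->
    (forall z, x ≼ z -> z ≼ y -> ~ bp P z) -> (P x <-> P y) }.

Lemma dfun_cst (S : dstr) : omin S ->
  forall (W : finType) (a : S), dfun (fun _ : W -> S => a).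
Proof. by move=> om W a; exact: (D1_app (om_cst om a) (dfun_var S (@None W))). Qed.

Ltac dfn_fun :=
  first
  [ apply: dfun_var
  | match goal with
    | H : dfun1 ?f |- dfun (fun e => ?f _) => apply: (dfun_app H)
    | H : dfun ?t |- dfun _ => exact: H
    | H : omin _ |- _ => exact: (dfun_cst H)
    | H : forall a, dfun1 _ |- _ => apply: (dfun_app (H _))
    | H : forall a, dfun _ |- _ => apply: H
    end ].

Ltac dfn_pred :=
  lazymatch goal with
  | |- D (fun e => _ /\ _) => apply: D_and
  | |- D (fun e => _ \/ _) => apply: D_or
  | |- D (fun e => ~ _) => apply: D_not
  | |- D (fun e => _ <-> _) => apply: D_iff
  | |- D (fun e => exists _, _) => apply: D_ex
  | |- D (fun e => _ -> _) => first [apply: D_imp | apply: D_all | apply: D_all_fin => ?]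
  | |- D (fun e => forall _, _) => first [apply: D_all | apply: D_all_fin => ?]
  | |- D (fun e => lt _ _) => apply: D_lt
  | |- D (fun e => _ = _) => apply: D_eq
  | |- D (fun e => card_le _ _) => apply: D_card_le
  | |- D (fun e => bp _ _) => rewrite /bp
  | |- D (fun e => near _ _) => rewrite /near
  | _ => first
    [ match goal with
      | H : D1 ?P |- D (fun e => ?P _) => apply: (D1_app H)
      | H : D2 ?P |- D (fun e => ?P _ _) => apply: (D2_app H)
      | H : D3 ?P |- D (fun e => ?P _ _ _) => apply: (D3_app H)
      end
    | apply: D_cst
    | match goal with H : forall _, _ |- _ => apply: H end ]
  end.

Ltac dfn_step :=
  cbv beta; lazymatch goal with |- dfun _ => dfn_fun | |- D _ => dfn_pred end.

Ltac dfn := rewrite /D1 /D2 /D3; repeat dfn_step.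

(** * One-variable o-minimality *)

Section Omin.
Variable S : dstr.
Hypothesis om : omin S.
Implicit Types (P : S -> Prop) (a b u v x y : S).

Definition dir_lt (s : bool) x y := if s then x ≺ y else y ≺ x.

Lemma near_and a P Q : near a P -> near a Q -> near a (fun t => P t /\ Q t).
Proof.
move=> [u [v [ua [av Pt]]]] [u' [v' [u'a [av' Qt]]]].
have [w [? [? ?]]] := between_max ua u'a.
have [w' [? [? ?]]] := between_min av av'.
by exists w, w'; split=> //; split=> // t wt tw'; split; [apply: Pt|apply: Qt]; order.
Qed.

Lemma near_sub a P Q : (forall t, P t -> Q t) -> near a P -> near a Q.
Proof.
by move=> PQ [u [v [? [? Pt]]]]; exists u, v; split=> //; split=> // t *; exact/PQ/Pt.
Qed.

Lemma nearT a P : (forall t, P t) -> near a P.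
Proof.
have [u ?] := unbounded_l a; have [v ?] := unbounded_r a.
by move=> Pt; exists u, v.
Qed.

(** A point of P that is not a breakpoint has a whole interval of P around it. *)
Lemma finite_thin P : D1 P ->
  (forall u v, u ≺ v -> exists x, u ≺ x /\ x ≺ v /\ ~ P x) -> finite_pred P.
Proof.
move=> dP thin; apply: finite_sub (om_fin om dP) => x Px [u [v [ux [xv Pc]]]].
have [y [uy [yv nPy]]] := thin _ _ (lt_trans ux xv).
by apply/nPy/Pc.
Qed.

Lemma finite_escape P u v :
  finite_pred P -> u ≺ v -> exists x, u ≺ x /\ x ≺ v /\ ~ P x.
Proof.
move=> Pfin uv; apply: contrapT => nx; apply: (interval_infinite uv).
apply: finite_sub Pfin => x [ux xv]; apply: contrapT => nPx.
by apply: nx; exists x.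
Qed.

(** Finitely many breakpoints leave an interval next to a that is free of them, and [om_const]
    applies on it. *)
Lemma eventually (s : bool) P a : D1 P -> exists2 v, dir_lt s a v &
  (forall y, dir_lt s a y -> dir_lt s y v -> P y) \/
  (forall y, dir_lt s a y -> dir_lt s y v -> ~ P y).
Proof.
move=> dP.
have [v av nbp] : exists2 v, dir_lt s a v &
    forall y, dir_lt s a y -> dir_lt s y v -> ~ bp P y.
  case: s; first exact: finite_free_r (om_fin om dP).
  have [v va nbp] := finite_free_l a (om_fin om dP).
  by exists v => // y ya vy; apply: nbp.
exists v => //.
have [?|/existsNP[y0 /not_implyP[ay0 /not_implyP[y0v nPy0]]]] :=
  pselect (forall y, dir_lt s a y -> dir_lt s y v -> P y); first by left.
right=> y ay yv Py; case: (lt_total y y0) => [lt|[eq|lt]].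
- case: nPy0; apply/(om_const om dP lt) => // z yz zy0; apply: nbp.
    by case: s ay ay0 {av} yv y0v => /= *; order.
  by case: s ay ay0 {av} yv y0v => /= *; order.
- by rewrite -eq in nPy0.
case: nPy0; apply/(om_const om dP lt) => // z yz zy0; apply: nbp.
  by case: s ay ay0 {av} yv y0v => /= *; order.
by case: s ay ay0 {av} yv y0v => /= *; order.
Qed.

(* Otherwise, for every y, the set F y of the points c such that no x of [y, c)
   satisfies Q x on (x, c) is finite, and non-empty for y close to b. The
   maxima of these sets fill an interval (w, b), and this forces F y to contain
   (y, c) as soon as it contains c. *)
Lemma uniform_right (Q : S -> S -> Prop) a b : D2 Q -> a ≺ b ->
    (forall x, a ≺ x -> x ≺ b ->
       exists2 r, x ≺ r & forall y, x ≺ y -> y ≺ r -> Q x y) ->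
  exists u v, a ≼ u /\ u ≺ v /\ v ≼ b /\
    forall x y, u ≺ x -> x ≺ y -> y ≺ v -> Q x y.
Proof.
move=> dQ ab locQ; apply: contrapT => nK.
pose full x c := forall y, x ≺ y -> y ≺ c -> Q x y.
have dfull : D2 full by rewrite /full; dfn.
pose F y c := y ≺ c /\ forall x, y ≼ x -> x ≺ c -> ~ full x c.
have dF : D2 F by rewrite /F; dfn.
have notfull c : a ≺ c -> c ≺ b -> exists2 h, a ≺ h /\ h ≺ c &
    forall x, h ≺ x -> x ≺ c -> ~ full x c.
  move=> ac cb; have dP : D1 (fun x => full x c) by dfn.
  have [h0 h0c H] := eventually false c dP.
  have [h [ah [h0h hc]]] := between_max ac h0c; exists h => // x hx xc.
  case: H => [fullc|]; last by apply => //; apply: lt_trans h0h hx.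
  case: nK; exists h, c; do 3 (split; first by order).
  by move=> x' y hx' x'y yc; apply: (fullc x') => //=; order.
(* If F y contained an interval, local validity of Q at a point x of it would make [full x c] true
   for some c of that interval. *)
have Ffin y : a ≺ y -> finite_pred (fun c => F y c /\ c ≺ b).
  move=> ay; apply: finite_thin; first by dfn.
  move=> u v uv; apply: contrapT => nx.
  have Fy x : u ≺ x -> x ≺ v -> F y x /\ x ≺ b.
    by move=> ? ?; apply: contrapT => ?; apply: nx; exists x.
  have [x [ux xv]] := dense uv; have [[yx Fx] xb] := Fy x ux xv.
  have [r xr Qr] := locQ x (lt_trans ay yx) xb.
  have [c [xc [cr cv]]] := between_min xr xv.
  have [[yc Fc] cb] := Fy c (lt_trans ux xc) cv.
  apply: (Fc x) => //; first by order.
  by move=> z xz zc; apply: Qr => //; order.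
have [w0 w0b Fne] : exists2 w0, a ≺ w0 /\ w0 ≺ b &
    forall y, w0 ≺ y -> y ≺ b -> exists c, F y c /\ c ≺ b.
  have dP : D1 (fun y => exists c, F y c /\ c ≺ b) by dfn.
  have [w wb H] := eventually false b dP.
  have [w0 [aw0 [ww0 w0b]]] := between_max ab wb.
  exists w0 => // y w0y yb.
  case: H => [H|H]; first by apply: H => //; apply: lt_trans w0y.
  have [c [w0c cb]] := dense w0b.
  have [h [ah hc] nf] := notfull c (lt_trans aw0 w0c) cb.
  have [z [hz [w0z zc]]] := between_max hc w0c.
  case: (H z); [exact: lt_trans zc cb|exact: lt_trans w0z|].
  exists c; split=> //; split=> // x zx xc; apply: nf => //; order.
pose C c := c ≺ b /\ exists y, a ≺ y /\ F y c /\
  forall c', c ≺ c' -> c' ≺ b -> ~ F y c'.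
have dC : D1 C by rewrite /C; dfn.
have [w wb CC] : exists2 w, w ≺ b & forall c, w ≺ c -> c ≺ b -> C c.
  have [w wb [H|H]] := eventually false b dC.
    by exists w => // c wc cb; apply: H.
  have [y [wy [w0y yb]]] := between_max wb w0b.2.
  have ay : a ≺ y by order.
  have [c [Fyc cb] maxc] := finite_max (Ffin y ay) (Fne y w0y yb).
  case: (H c) => //; first by case: Fyc => yc _; apply: lt_trans wy yc.
  split=> //; exists y; split=> //; split=> // c' cc' c'b Fc'.
  exact: (maxc c').
have [y0 [wy0 [w0y0 y0b]]] := between_max wb w0b.2.
have [c0 [[y0c0 Fc0] c0b]] := Fne y0 w0y0 y0b.
have ay0 : a ≺ y0 by order.
apply: (interval_infinite y0c0); apply: finite_sub (Ffin y0 ay0) => c [y0c cc0].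
split; last by order.
have [cb [y [ay [[yc Fyc] nF]]]] := CC c (lt_trans wy0 y0c) (lt_trans cc0 c0b).
(* c is the maximum of F y. If y0 ≼ y held, then c0 would belong to F y beyond c. Hence y ≺ y0, and
   membership of c in F y entails membership in F y0. *)
have [x [yx xy0]] : exists x, y ≼ x /\ x ≺ y0.
  apply: contrapT => nx; apply: (nF c0) => //; split; first by order.
  move=> x yx xc0; apply: Fc0 => // xy0; apply: nx; by exists x.
by split=> // x' y0x' x'c; apply: Fyc => //; order.
Qed.

End Omin.

(** * Continuity of definable functions off a finite set *)

Section Reverse.
Variable S : dstr.

Definition reverse : dstr.
Proof.
refine (@Dstr S (pt S) (fun x y => lt y x) (@lt_irr S) _ _ _
  (@unbounded_r S) (@unbounded_l S) (@D S) (@D_and S) (@D_not S)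
  (@D_exists S) (@D_rename S) _ (@D_eq2 S)).
- by move=> y x z xy yz; apply: lt_trans yz xy.
- by move=> x y; have := lt_total x y; tauto.
- by move=> x y /dense[z [? ?]]; exists z.
- exact: (D_rename negb (D_lt2 S)).
Defined.

Lemma near_reverse (a : S) P : @near reverse a P <-> near a P.
Proof.
by split=> -[u [v [ua [av Pt]]]]; exists v, u; split=> //; split=> // t *; apply: Pt.
Qed.

Lemma omin_reverse : omin S -> omin reverse.
Proof.
move=> om; split.
- exact: (om_cst om).
- exact: (om_choice om).
- move=> P /(om_fin om); apply: finite_sub => x; rewrite /bp.
  by rewrite (propext (near_reverse _ _)).
- move=> P dP x y yx nbp; split=> Px.
    apply/(om_const om dP yx) => // z ? ?.
    by have := nbp z; rewrite /bp (propext (near_reverse _ _)); apply.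
  apply/(om_const om dP yx) => // z ? ?.
  by have := nbp z; rewrite /bp (propext (near_reverse _ _)); apply.
Qed.

End Reverse.

Section JumpRight.
Variable S : dstr.
Hypothesis om : omin S.
Implicit Types (P : S -> Prop) (f : S -> S) (a b u v x y : S).

Definition cont f a := forall c d, c ≺ f a -> f a ≺ d ->
  near a (fun t => c ≺ f t /\ f t ≺ d).

(* [jump s s' f x]: on the side [s] of [x], the function [f] stays away from
   [f x] on the side [s'] of [f x]. *)
Definition jump (s s' : bool) f x := exists d, dir_lt s' (f x) d /\
  exists v, dir_lt s x v /\ forall t, dir_lt s x t -> dir_lt s t v -> ~ dir_lt s' (f t) d.

Lemma dir_lt_irr s x : ~ dir_lt s x x. Proof. by case: s; apply: lt_irr. Qed.

Lemma dir_lt_trans s y x z : dir_lt s x y -> dir_lt s y z -> dir_lt s x z.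
Proof. by case: s => /= *; order. Qed.

Lemma dir_lt_le_trans s y x z : dir_lt s x y -> ~ dir_lt s z y -> dir_lt s x z.
Proof. by case: s => /= *; order. Qed.

(* Otherwise f would be strictly monotone on an interval, whose image contains
   an interval although it has a gap next to each of its points. *)
Lemma no_jump_right s f a b : dfun1 f -> a ≺ b ->
  ~ forall x, a ≺ x -> x ≺ b -> jump true s f x.
Proof.
move=> df ab J.
have dQ : D2 (fun x y => dir_lt s (f x) (f y)) by case: s {J} => /=; dfn.
have [u [v [au [uv [vb mono]]]]] : exists u v, a ≼ u /\ u ≺ v /\ v ≼ b /\
    forall x y, u ≺ x -> x ≺ y -> y ≺ v -> dir_lt s (f x) (f y).
  apply: (uniform_right om dQ ab) => x ax xb.
  have [d [fxd [r [xr Hr]]]] := J x ax xb; exists r => // y xy yr.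
  exact: dir_lt_le_trans fxd (Hr y xy yr).
pose I y := exists x, u ≺ x /\ x ≺ v /\ y = f x.
have dI : D1 I by rewrite /I; dfn.
have [x0 [ux0 x0v]] := dense uv.
have [Ifin|Iinf] := pselect (finite_pred I).
  have [y Iy maxy] : exists2 y, I y & forall z, I z -> ~ dir_lt s y z.
    have Ine : exists y, I y by exists (f x0), x0.
    by case: s {J dQ mono} => /=; [exact: finite_max|exact: finite_min].
  case: Iy maxy => x [ux [xv ->]] maxy; have [z [xz zv]] := dense xv.
  apply: (maxy (f z)); last exact: mono.
  by exists z; split; [apply: lt_trans ux xz|].
have [p [q [pq sub]]] : exists p q, p ≺ q /\ forall y, p ≺ y -> y ≺ q -> I y.
  apply: contrapT => nI; apply: Iinf; apply: (finite_thin om dI) => p q pq.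
  apply: contrapT => ny; apply: nI; exists p, q; split=> // y py yq.
  by apply: contrapT => nIy; apply: ny; exists y.
have [y [py yq]] := dense pq; have [x [ux [xv yE]]] := sub y py yq; subst y.
have [ax xb] : a ≺ x /\ x ≺ b by order.
have [d [fxd [r [xr Hr]]]] := J x ax xb.
have [e [pe [eq [fxe ed]]]] :
    exists e, p ≺ e /\ e ≺ q /\ dir_lt s (f x) e /\ dir_lt s e d.
  case: s {J dQ mono Hr} fxd => /= fxd.
    by have [e [? [? ?]]] := between_min fxd yq; exists e; order.
  by have [e [? [? ?]]] := between_max fxd py; exists e; order.
have [z [uz [zv eE]]] := sub e pe eq; subst e.
case: (lt_total x z) => [xz|[xz|zx]].
- have [w [xw [wr wz]]] := between_min xr xz.
  have wz' : dir_lt s (f w) (f z) by apply: mono => //; order.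
  exact: (Hr w xw wr (dir_lt_trans wz' ed)).
- by move: fxe; rewrite xz; apply: dir_lt_irr.
- exact: (@dir_lt_irr s (f x) (dir_lt_trans fxe (mono z x uz zx xv))).
Qed.

End JumpRight.

Section Continuity.
Variable S : dstr.
Hypothesis om : omin S.
Implicit Types (P : S -> Prop) (f : S -> S) (a b u v x y : S).

(** Left jumps become right jumps in the reversed order. The values are reversed as well, whence the
    negation of [s']. *)
Lemma no_jump s s' f a b : dfun1 f -> a ≺ b ->
  ~ forall x, a ≺ x -> x ≺ b -> jump s s' f x.
Proof.
move=> df ab; case: s; first exact: no_jump_right.
move=> J; have df' : @dfun1 (reverse S) f := df.
have ab' : @lt (reverse S) b a := ab.
apply: (no_jump_right (S := reverse S) (s := ~~ s') (omin_reverse om) df' ab').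
by move=> x bx xa; have := J x xa bx; case: (s').
Qed.

(** At a discontinuity f stays, on one side of a, at or beyond one of the bounds c and d; this is
    one of the four kinds of jump. *)
Lemma cont_cofinite f : dfun1 f -> finite_pred (fun a => ~ cont f a).
Proof.
move=> df.
have Jfin s s' : finite_pred (jump s s' f).
  apply: (finite_thin om); first by case: s; case: s' => /=; rewrite /jump /=; dfn.
  move=> u v uv; apply: contrapT => nx; apply: (@no_jump s s' f u v df uv) => x ux xv.
  by apply: contrapT => nJ; apply: nx; exists x.
apply: finite_sub (finiteU (finiteU (Jfin true true) (Jfin true false))
                           (finiteU (Jfin false true) (Jfin false false))) => a nc.
apply: contrapT => nJ; apply: nc => c d cfa fad.
have ev s : exists2 v, dir_lt s a v &
    forall y, dir_lt s a y -> dir_lt s y v -> c ≺ f y /\ f y ≺ d.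
  have dc : D1 (fun y => c ≺ f y) by dfn.
  have dd : D1 (fun y => f y ≺ d) by dfn.
  have [v1 av1 H1] := eventually om s a dc.
  have [v2 av2 H2] := eventually om s a dd.
  have K1 : forall y, dir_lt s a y -> dir_lt s y v1 -> c ≺ f y.
    case: H1 => // H1; case: nJ.
    have : jump s false f a by exists c; split=> //; exists v1.
    by case: s {av1 av2 H1 H2}; tauto.
  have K2 : forall y, dir_lt s a y -> dir_lt s y v2 -> f y ≺ d.
    case: H2 => // H2; case: nJ.
    have : jump s true f a by exists d; split=> //; exists v2.
    by case: s {av1 av2 H1 H2 K1}; tauto.
  have [v [av [vv1 vv2]]] : exists v, dir_lt s a v /\ dir_lt s v v1 /\ dir_lt s v v2.
    case: s av1 av2 {H1 H2 K1 K2} => /= av1 av2; first exact: between_min.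
    by have [v [? [? ?]]] := between_max av1 av2; exists v.
  exists v => // y ay yv; split; [apply: K1|apply: K2] => //.
    exact: dir_lt_trans yv vv1.
  exact: dir_lt_trans yv vv2.
have [v av Hv] := ev true; have [u ua Hu] := ev false.
exists u, v; split=> //; split=> // t ut tv.
by case: (lt_total t a) => [ta|[->|ta]]; [apply: Hu| |apply: Hv].
Qed.

Lemma choice1 (Q : S -> S -> Prop) : D2 Q ->
  exists2 f, dfun1 f & forall t, (exists a, Q t a) -> Q t (f t).
Proof.
move=> dQ.
have dP : D (fun e : option unit -> S => Q (e (Some tt)) (e None)) by dfn.
have [F dF HF] := om_choice om dP.
exists (fun t => F (fun _ => t)).
  rewrite /dfun1 /D2.
  have := D_rename (fun o : option unit => if o is Some _ then false else true) dF.
  by [].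
by move=> t [a Qa]; apply: (HF (fun _ => t)); exists a.
Qed.

End Continuity.

(** * Uniform finiteness for families with one parameter *)

Section UniformFiniteness1.
Variable S : dstr.
Hypothesis om : omin S.
Implicit Types (A : S -> S -> Prop) (a b u v x y : S).

(** The normal points of the classical finiteness lemma: in arbitrarily small boxes around (a, b),
    the set A is the graph of a function of t if it contains (a, b), and empty otherwise. *)
Definition isolated A a b := forall c d, c ≺ b -> b ≺ d ->
  exists c' d', (c ≼ c' /\ c' ≺ b /\ b ≺ d' /\ d' ≼ d) /\
  near a (fun t =>
    (A a b -> exists y, (c' ≺ y /\ y ≺ d' /\ A t y) /\
       forall z, c' ≺ z -> z ≺ d' -> A t z -> z = y) /\
    (~ A a b -> forall z, c' ≺ z -> z ≺ d' -> ~ A t z)).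

Definition bounded_at A a := exists e1 e2,
  near a (fun t => forall y, A t y -> e1 ≺ y /\ y ≺ e2).

(** Choice yields definable functions above and below all fibers; at a common point of continuity
    these bound the nearby fibers. *)
Lemma bounded_cofinite A : D2 A -> (forall t, finite_pred (A t)) ->
  finite_pred (fun a => ~ bounded_at A a).
Proof.
move=> dA Afin.
have [f df Hf] : exists2 f : S -> S, dfun1 f & forall t y, A t y -> y ≺ f t.
  have dQ : D2 (fun t a => forall y, A t y -> y ≺ a) by dfn.
  have [f df Hf] := choice1 om dQ; exists f => // t; apply: Hf.
  have [At|nAt] := pselect (exists y, A t y); last first.
    by exists (pt S) => y Aty; case: nAt; exists y.
  have [m Am maxm] := finite_max (Afin t) At; have [e me] := unbounded_r m.
  by exists e => y /maxm ?; order.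
have [g dg Hg] : exists2 f : S -> S, dfun1 f & forall t y, A t y -> f t ≺ y.
  have dQ : D2 (fun t a => forall y, A t y -> a ≺ y) by dfn.
  have [g dg Hg] := choice1 om dQ; exists g => // t; apply: Hg.
  have [At|nAt] := pselect (exists y, A t y); last first.
    by exists (pt S) => y Aty; case: nAt; exists y.
  have [m Am maxm] := finite_min (Afin t) At; have [e me] := unbounded_l m.
  by exists e => y /maxm ?; order.
apply: finite_sub (finiteU (cont_cofinite om df) (cont_cofinite om dg)) => a.
apply: contra_notP => /not_orP[/contrapT cf /contrapT cg].
have [e2 fe2] := unbounded_r (f a); have [x fx] := unbounded_l (f a).
have [e1 ge1] := unbounded_l (g a); have [x' gx'] := unbounded_r (g a).
exists e1, e2; apply: near_sub (near_and (cf _ _ fx fe2) (cg _ _ ge1 gx')).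
by move=> t [[_ ?] [? _]] y Aty; move: (Hf _ _ Aty) (Hg _ _ Aty) => ? ?; order.
Qed.

(** On an interval of exceptions, choose a bad point f t together with ends g t and h t such that
    the fiber has no point between them except possibly f t. Where f, g, h are continuous and
    membership of f t is locally constant, A is near (t, f t) either the graph of f or empty. *)
Lemma isolated_cofinite A : D2 A -> (forall t, finite_pred (A t)) ->
  finite_pred (fun a => exists b, ~ isolated A a b).
Proof.
move=> dA Afin.
have dI : D2 (isolated A) by rewrite /isolated; dfn.
have dN : D2 (fun a b => ~ isolated A a b) by dfn.
apply: (finite_thin om); first by dfn.
move=> u v uv; apply: contrapT => nx.
have [f df Hf] := choice1 om dN.
have {}Hf t : u ≺ t -> t ≺ v -> ~ isolated A t (f t).
  by move=> ut tv; apply: Hf; apply: contrapT => nb; apply: nx; exists t.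
have [g dg Hg] : exists2 g : S -> S, dfun1 g & forall t,
    g t ≺ f t /\ forall z, g t ≺ z -> z ≺ f t -> ~ A t z.
  have dQ : D2 (fun t a => a ≺ f t /\ forall z, a ≺ z -> z ≺ f t -> ~ A t z).
    by dfn.
  have [g dg Hg] := choice1 om dQ; exists g => // t; apply: Hg.
  by have [e ? ?] := finite_free_l (f t) (Afin t); exists e.
have [h dh Hh] : exists2 h : S -> S, dfun1 h & forall t,
    f t ≺ h t /\ forall z, f t ≺ z -> z ≺ h t -> ~ A t z.
  have dQ : D2 (fun t a => f t ≺ a /\ forall z, f t ≺ z -> z ≺ a -> ~ A t z).
    by dfn.
  have [h dh Hh] := choice1 om dQ; exists h => // t; apply: Hh.
  by have [e ? ?] := finite_free_r (f t) (Afin t); exists e.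
have dB : D1 (fun t => A t (f t)) by dfn.
have [x [ux [xv /not_orP[/not_orP[/contrapT cf /contrapT cg]
                         /not_orP[/contrapT ch /contrapT nbx]]]]] :=
  finite_escape (finiteU
    (finiteU (cont_cofinite om df) (cont_cofinite om dg))
    (finiteU (cont_cofinite om dh) (om_fin om dB))) uv.
apply: (Hf x ux xv) => c d cf' fd.
have [c' [cc' [gc' c'f]]] := between_max cf' (Hg x).1.
have [d' [fd' [d'd d'h]]] := between_min fd (Hh x).1.
have [e1 eg] := unbounded_l (g x); have [e2 he] := unbounded_r (h x).
exists c', d'; split; first by split; order.
apply: near_sub (near_and (near_and (cf _ _ c'f fd') nbx)
  (near_and (cg _ _ eg gc') (ch _ _ d'h he))).
move=> t [[[c'ft ftd'] At] [[_ gtc'] [d'ht _]]].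
have uniq z : c' ≺ z -> z ≺ d' -> A t z -> z = f t.
  move=> c'z zd' Atz; case: (lt_total z (f t)) => [lt|[//|lt]].
    by case: ((Hg t).2 z _ lt Atz); order.
  by case: ((Hh t).2 z lt _ Atz); order.
split=> [/At Atf|nAx z c'z zd' Atz].
  by exists (f t); split.
by apply/nAx/At; rewrite -(uniq z).
Qed.

Lemma near_side s a v P : dir_lt s a v -> near a P ->
  exists2 t, dir_lt s a t /\ dir_lt s t v & P t.
Proof.
move=> av [u [w [ua [aw Pt]]]]; case: s av => /= av.
  have [t [? [? ?]]] := between_min av aw; exists t => //; apply: Pt; order.
have [t [? [? ?]]] := between_max av ua; exists t => //; apply: Pt; order.
Qed.

(** Otherwise the fibers next to a, on one side, are non-empty and lie between e1 and e2. The
    heights c below which they all reach form a set Z that contains e2 but not e1; at a breakpoint b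
    of Z the empty box around (a, b) gives a contradiction. *)
Lemma empty_near A a : D2 A -> bounded_at A a ->
    (forall b, isolated A a b) -> (forall b, ~ A a b) ->
  near a (fun t => forall y, ~ A t y).
Proof.
move=> dA [e1 [e2 bdA]] iso Aa.
have side s : exists2 v, dir_lt s a v &
    forall t, dir_lt s a t -> dir_lt s t v -> forall y, ~ A t y.
  have dE : D1 (fun t => exists y, A t y) by dfn.
  have [v av [ne|E]] := eventually om s a dE; last first.
    by exists v => // t at_ tv y Ay; apply: (E t) => //; exists y.
  pose Z c := exists v, dir_lt s a v /\
    forall t, dir_lt s a t -> dir_lt s t v -> exists y, y ≼ c /\ A t y.
  have dZ : D1 Z by rewrite /Z; case: s {av ne Z} => /=; dfn.
  have [t [at_ tv] bt] := near_side av bdA.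
  have [y /bt [e1y ye2]] := ne t at_ tv.
  have e12 : e1 ≺ e2 by order.
  have trans w x P : dir_lt s a w -> near a P -> dir_lt s a x ->
      exists2 w', dir_lt s a w' & forall t, dir_lt s a t -> dir_lt s t w' ->
        dir_lt s t w /\ P t.
    move=> aw [p [q [pa [aq Pt]]]] _; case: s {av ne Z dZ at_ tv} aw => /= aw.
      have [w' [? [? ?]]] := between_min aw aq; exists w' => // t' ? ?.
      by split; [order|apply: Pt; order].
    have [w' [? [? ?]]] := between_max aw pa; exists w' => // t' ? ?.
    by split; [order|apply: Pt; order].
  have Z2 : Z e2.
    have [w aw Hw] := trans _ v _ av bdA av; exists w; split=> // t' at' t'w.
    have [t'v bt'] := Hw t' at' t'w; have [z Az] := ne t' at' t'v.
    by exists z; split=> //; have [? ?] := bt' z Az; order.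
  have nZ1 : ~ Z e1.
    move=> [w [aw Hw]]; have [t' [at' t'w] bt'] := near_side aw bdA.
    by have [z [ze1 /bt'[? ?]]] := Hw t' at' t'w; order.
  suff: Z e1 <-> Z e2 by tauto.
  apply: (om_const om dZ e12) => b _ _; apply.
  have [c cb] := unbounded_l b; have [d bd] := unbounded_r b.
  have [c' [d' [[_ [c'b [bd' _]]] nb]]] := iso b c d cb bd.
  have ZZ z z' : c' ≺ z -> z ≺ d' -> c' ≺ z' -> z' ≺ d' -> Z z -> Z z'.
    move=> c'z zd' c'z' z'd' [w [aw Hw]].
    have [w' aw' Hw'] := trans _ w _ aw nb aw.
    exists w'; split=> // t' at' t'w'; have [t'w [_ emp]] := Hw' t' at' t'w'.
    have [x [xz Ax]] := Hw t' at' t'w; exists x; split=> // z'x.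
    by apply: (emp (Aa b) x) => //; order.
  by exists c', d'; split=> //; split=> // z ? ?; split; apply: ZZ.
have [v av Hv] := side true; have [u ua Hu] := side false.
exists u, v; split=> //; split=> // t ut tv.
by case: (lt_total t a) => [ta|[->|ta]]; [apply: Hu|apply: Aa|apply: Hv].
Qed.

(** Induction on the fiber over a: a single branch of A passes through a point x1 of it, and
    deleting a strip around that branch removes exactly one point from every nearby fiber. *)
Lemma card_near A a : D2 A -> finite_pred (A a) -> bounded_at A a ->
    (forall b, isolated A a b) ->
  near a (fun t => forall n, card_le n (A t) <-> card_le n (A a)).
Proof.
move=> + [n]; elim: n A => [|n IH] A dA.
  move=> Aa bdA iso; apply: near_sub (empty_near dA bdA iso Aa) => t At n.
  by split; apply: card_le_sub => x; [move/Aa|move/At].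
move=> An bdA iso.
have [[x1 Ax1]|nA] := pselect (exists x, A a x); last first.
  have Aa b : ~ A a b by move=> Ab; apply: nA; exists b.
  apply: near_sub (empty_near dA bdA iso Aa) => t At m.
  by split; apply: card_le_sub => x; [move/Aa|move/At].
have Afin : finite_pred (A a) by exists n.+1.
have [c0 c0x1 free_l] := finite_free_l x1 Afin.
have [d0 x1d0 free_r] := finite_free_r x1 Afin.
(* Strictly inside the gap around x1, so that the closed interval from c1 to d1 meets the fiber in
   x1 only. *)
have [c1 [c0c1 c1x1]] := dense c0x1; have [d1 [x1d1 d1d0]] := dense x1d0.
have iso1 y : A a y -> c1 ≼ y -> y ≼ d1 -> y = x1.
  move=> Ay cy yd; case: (lt_total y x1) => [lt|[//|lt]].
    by case: (free_l y _ lt Ay); order.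
  by case: (free_r y lt _ Ay); order.
have [c [d [[c1c [cx1 [x1d dd1]]] Bnear]]] := iso x1 c1 d1 c1x1 x1d1.
pose A' t x := A t x /\ ~ (c ≺ x /\ x ≺ d).
have dA' : D2 A' by rewrite /A'; dfn.
have A'a x : A' a x <-> A a x /\ x <> x1.
  split=> [[Ax nx]|[Ax nx]]; split=> //.
    by move=> xE; apply: nx; rewrite xE.
  by move=> [? ?]; apply: nx; apply: iso1 => //; order.
have A'fin : card_le n (A' a).
  by apply: card_le_sub ((card_leS_rem n Ax1).1 An) => x /A'a.
have bdA' : bounded_at A' a.
  have [e1 [e2 H]] := bdA; exists e1, e2; apply: near_sub H => t H y [Ay _].
  exact: H.
(* Three cases: a remaining point of the fiber has a box off the strip; at a point outside the fiber
   the box for A still works; at a deleted point any box inside the strip is empty. *)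
have iso' b : isolated A' a b.
  move=> p q pb bq.
  have [A'b|nA'b] := pselect (A' a b).
    have [Ab nb] := (A'a b).1 A'b.
    have [p' [q' [pp' [p'b [bq' [q'q off]]]]]] : exists p' q',
      p ≼ p' /\ p' ≺ b /\ b ≺ q' /\ q' ≼ q /\
      forall z, p' ≺ z -> z ≺ q' -> ~ (c ≺ z /\ z ≺ d).
      have [bc1|d1b] : b ≺ c1 \/ d1 ≺ b.
      - by apply: contrapT => /not_orP[? ?]; apply: nb; apply: iso1.
      - have [r [br [rc rq]]] := between_min bc1 bq.
        by exists p, r; do 4 (split; first order); move=> z *; order.
      have [r [dr [pr rb]]] := between_max d1b pb.
      by exists r, q; do 4 (split; first order); move=> z *; order.
    have [p2 [q2 [[? [? [? ?]]] H]]] := iso b p' q' p'b bq'.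
    exists p2, q2; split; first by split; order.
    apply: near_sub H => t [/(_ Ab) [y [[p2y [yq2 Ay]] uniqy]] _].
    split=> // _; exists y; split.
      by do 2 (split=> //); split=> //; apply: off; order.
    by move=> z ? ? [Az _]; apply: uniqy.
  have [Ab|nAb] := pselect (A a b); last first.
    have [p2 [q2 [bds H]]] := iso b p q pb bq; exists p2, q2; split=> //.
    apply: near_sub H => t [_ /(_ nAb) emp]; split=> // _ z ? ? [Az _].
    exact: (emp z).
  have [cb bd] : c ≺ b /\ b ≺ d by apply: contrapT => nb; apply: nA'b.
  have [p2 [pp2 [cp2 p2b]]] := between_max pb cb.
  have [q2 [bq2 [q2q q2d]]] := between_min bq bd.
  exists p2, q2; split; first by split; order.
  apply: nearT => t; split=> // _ z p2z zq2 [_]; apply; split; order.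
apply: near_sub (near_and Bnear (IH A' dA' A'fin bdA' iso')) => t.
move=> [[/(_ Ax1) [y [[cy [yd Ay]] uniqy]] _] Ht] [|m].
  by split=> [/(_ y)|/(_ x1)].
rewrite (propext (card_leS_rem m Ay)) (propext (card_leS_rem m Ax1)).
have E1 : (fun x => A a x /\ x <> x1) = A' a.
  by apply/funext => x; apply/propext; rewrite A'a.
have E2 : (fun x => A t x /\ x <> y) = A' t.
  apply/funext => x; apply/propext; split=> -[Ax nx]; split=> //.
    by move=> [cx xd]; apply: nx; apply: uniqy.
  by move=> xE; apply: nx; rewrite xE.
by rewrite E1 E2.
Qed.

Definition unseparated (B : S -> Prop) t t' :=
  t = t' \/ forall z, B z -> ~ (t ≼ z /\ z ≼ t') /\ ~ (t' ≼ z /\ z ≼ t).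

(** B cuts the line into finitely many classes, so the bounds on the classes have a maximum. *)
Lemma bounded_classes (B : S -> Prop) (Bd : nat -> S -> Prop) :
    finite_pred B -> (forall m n t, m <= n -> Bd m t -> Bd n t) ->
  forall X : S -> Prop, (forall t0, X t0 -> exists N, forall t, X t ->
      unseparated B t t0 -> Bd N t) ->
    exists N, forall t, X t -> Bd N t.
Proof.
move=> Bfin mono; elim/finite_ind: Bfin => {}B.
  move=> B0 X HX; have [[t0 Xt0]|nX] := pselect (exists t, X t); last first.
    by exists 0 => t Xt; case: nX; exists t.
  have [N HN] := HX t0 Xt0; exists N => t Xt; apply: HN => //.
  by right=> z /B0.
move=> y By IH X HX.
have [N1 H1] : exists N, forall t, X t /\ t ≺ y -> Bd N t.
  apply: IH => t0 [Xt0 t0y]; have [N HN] := HX t0 Xt0.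
  exists N => t [Xt ty] sep; apply: HN => //; case: sep => [|sep]; first by left.
  right=> z Bz; have [->|zy] := pselect (z = y); last exact: sep.
  by split=> -[? ?]; order.
have [N2 H2] : exists N, forall t, X t /\ y ≺ t -> Bd N t.
  apply: IH => t0 [Xt0 t0y]; have [N HN] := HX t0 Xt0.
  exists N => t [Xt ty] sep; apply: HN => //; case: sep => [|sep]; first by left.
  right=> z Bz; have [->|zy] := pselect (z = y); last exact: sep.
  by split=> -[? ?]; order.
have [N3 H3] : exists N, X y -> Bd N y.
  have [/HX[N HN]|] := pselect (X y); last by exists 0.
  by exists N => Xy; apply: HN => //; left.
exists (maxn (maxn N1 N2) N3) => t Xt.
case: (lt_total t y) => [ty|[tE|yt]].
- by apply: mono (H1 t _) => //; rewrite -maxnA leq_maxl.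
- by subst t; apply: mono (H3 Xt); rewrite leq_maxr.
- by apply: mono (H2 t _) => //; rewrite (maxnC N1) -maxnA leq_maxl.
Qed.

(** Off the finite set B of bad parameters the size of the fiber is locally constant, hence constant
    between points of B. *)
Lemma uniform_finiteness1 A : D2 A -> (forall t, finite_pred (A t)) ->
  exists N, forall t, card_le N (A t).
Proof.
move=> dA Afin.
pose B a := ~ bounded_at A a \/ exists b, ~ isolated A a b.
have Bfin : finite_pred B.
  by apply: finiteU; [exact: bounded_cofinite|exact: isolated_cofinite].
have [||N HN] := bounded_classes (Bd := fun n t => card_le n (A t))
    Bfin _ (X := fun _ => True) _; last by exists N => t; apply: HN.
  by move=> m n t mn; apply: (card_le_weak (pt S)).
move=> t0 _; have [N AN] := Afin t0; exists N => t _ [->//|sep].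
have nbp z : ~ B z -> ~ bp (fun t => card_le N (A t)) z.
  move=> /not_orP[/contrapT bz nz]; apply.
  have iso b : isolated A z b by apply: contrapT => nb; apply: nz; exists b.
  by apply: near_sub (card_near dA (Afin z) bz iso) => t' /(_ N).
have dC : D1 (fun t => card_le N (A t)) by dfn.
case: (lt_total t t0) => [tt0|[->//|t0t]].
  apply/(om_const om dC tt0) => // z tz zt0; apply: nbp => /sep[+ _].
  by apply.
apply/(om_const om dC t0t) => // z tz zt0; apply: nbp => /sep[_ +].
by apply.
Qed.

End UniformFiniteness1.

(** * Uniform finiteness *)

Section Tuples.
Variable S : dstr.

Fixpoint vars (k : nat) : finType :=
  if k is k'.+1 then option (vars k') : finType else void.

Lemma oapp_eta (W : Type) (e : option W -> S) :
  oapp (fun w => e (Some w)) (e None) = e.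
Proof. by apply/funext => -[]. Qed.

Lemma D_rename_oapp (W W' : finType) (P : (option W -> S) -> Prop)
    (g : W -> W') (v : W') :
  D P -> D (fun e : W' -> S => P (oapp (fun w => e (g w)) (e v))).
Proof.
move=> /(D_rename (oapp g v)); apply: D_ext => e.
by rewrite (_ : (fun w => e (oapp g v w)) = oapp (fun w => e (g w)) (e v)) //;
  apply/funext => -[].
Qed.

Lemma D_card_bp (W : finType) n (P : (option W -> S) -> Prop) : D P ->
  D (fun e => card_le n (bp (fun x => P (oapp e x)))).
Proof.
move=> dP; rewrite /bp /near; dfn.
all: try exact: (D_rename_oapp (fun w => _) _ dP).
Qed.

Lemma dfun1_comp (W : finType) (F : (W -> S) -> S) (g : W -> S -> S) :
  dfun F -> (forall w, dfun1 (g w)) -> dfun1 (fun t => F (fun w => g w t)).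
Proof.
move=> dF dg; pose t (o : option W) (e : bool -> S) :=
  if o is Some w then g w (e false) else e true.
have dt o : dfun (t o).
  by case: o => [w|]; [exact: (dfun_app (dg w) (dfun_var S false))|
                       exact: (dfun_var S true)].
exact: (D_subst dF dt).
Qed.

Definition swap (W : Type) (o : option (option W)) : option (option W) :=
  if o is Some o' then if o' is Some w then Some (Some w) else None
  else Some None.

(** [om_choice] gives one coordinate in terms of t and the others; substituting it leaves a problem
    with fewer coordinates. *)
Lemma choice_vars k (Q : S -> (vars k -> S) -> Prop) : omin S ->
    D (fun e : option (vars k) -> S => Q (e None) (fun w => e (Some w))) ->
  exists2 F : S -> vars k -> S, (forall w, dfun1 (fun t => F t w)) &
    forall t, (exists e, Q t e) -> Q t (F t).
Proof.
move=> om; elim: k Q => [|k IH] Q dQ.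
  exists (fun t (w : void) => of_void S w) => [[]|t [e Qe]].
  by rewrite (_ : of_void S = e) //; apply/funext => -[].
have dQ' : D (fun e : option (option (vars k)) -> S =>
    Q (e (Some None)) (oapp (fun w => e (Some (Some w))) (e None))).
  have := D_rename (@swap (vars k)) dQ; apply: D_ext => e.
  rewrite (_ : (fun w => e (swap (Some w))) =
     oapp (fun w => e (Some (Some w))) (e None)) //.
  by apply/funext => -[].
have [G dG HG] := om_choice om dQ'.
have dQG : D (fun e : option (vars k) -> S =>
  Q (e None) (oapp (fun w => e (Some w)) (G e))) := D_subst1 dQ' dG.
pose Q1 t (e : vars k -> S) := Q t (oapp e (G (oapp e t))).
have [|F dF HF] := IH Q1.
  apply: D_ext dQG => e; rewrite /Q1.
  by rewrite (oapp_eta e).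
have dG' : dfun1 (fun t => G (oapp (F t) t)).
  have dg (o : option (vars k)) : dfun1 (fun t => oapp (F t) t o).
    by case: o => [w|] /=; [exact: dF|exact: D_eq2].
  exact: (dfun1_comp dG dg).
exists (fun t => oapp (F t) (G (oapp (F t) t))).
  by case=> [w|] /=; [apply: dF|].
move=> t [e Qe]; apply: HF; exists (fun w => e (Some w)).
have := HG (oapp (fun w => e (Some w)) t); apply.
by exists (e None) => /=; rewrite (oapp_eta e).
Qed.

End Tuples.

(** * Germs of definable functions modulo an ultrafilter *)

Section Ultrapower.
Variable S : dstr.
Hypothesis om : omin S.
Variable U : set_system S.
Hypothesis UU : UltraFilter U.

Lemma ae_sub (P Q : S -> Prop) : (forall t, P t -> Q t) -> U P -> U Q.
Proof. by move=> PQ; apply: filterS. Qed.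

Lemma aeT (P : S -> Prop) : (forall t, P t) -> U P.
Proof. exact: filterE. Qed.

Lemma ae_and (P Q : S -> Prop) : U (fun t => P t /\ Q t) <-> U P /\ U Q.
Proof.
split=> [UPQ|[UP UQ]]; last exact: (filterI UP UQ).
by split; apply: ae_sub UPQ => t [].
Qed.

Lemma ae_not (P : S -> Prop) : U (fun t => ~ P t) <-> ~ U P.
Proof.
split=> [UnP UP|nUP]; last by case: (in_ultra_setVsetC P UU).
have : U set0 by apply: ae_sub ((ae_and _ _).2 (conj UP UnP)) => t [].
exact: filter_not_empty.
Qed.

Lemma ae_ext (P Q : S -> Prop) : (forall t, P t <-> Q t) -> U P <-> U Q.
Proof. by move=> PQ; split; apply: ae_sub => t /PQ. Qed.

Lemma ae_imp (P Q : S -> Prop) : U (fun t => P t -> Q t) <-> (U P -> U Q).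
Proof.
split=> [UPQ UP|UPUQ].
  by apply: ae_sub ((ae_and _ _).2 (conj UPQ UP)) => t [PQ /PQ].
have [/UPUQ|/ae_not] := pselect (U P); first by apply: ae_sub.
by apply: ae_sub => t nP /nP.
Qed.

Lemma ae_iff (P Q : S -> Prop) : U (fun t => P t <-> Q t) <-> (U P <-> U Q).
Proof. by rewrite /iff ae_and !ae_imp. Qed.

Definition ae_eq (f g : S -> S) := U (fun t => f t = g t).

Lemma canon_ex f : dfun1 f -> exists g, dfun1 g /\ ae_eq f g.
Proof. by move=> df; exists f; split=> //; apply: aeT. Qed.

(** The choice is made from a predicate that depends on the class of f only, so that equivalent
    functions get the same representative. *)
Definition canon f (df : dfun1 f) := sval (cid (canon_ex df)).

Lemma canonP f (df : dfun1 f) : dfun1 (canon df) /\ ae_eq f (canon df).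
Proof. by rewrite /canon; case: cid. Qed.

Lemma canon_eq f g (df : dfun1 f) (dg : dfun1 g) :
  ae_eq f g -> canon df = canon dg.
Proof.
move=> fg; rewrite /canon; move: (canon_ex df) (canon_ex dg).
have -> : (fun h => dfun1 h /\ ae_eq f h) = (fun h => dfun1 h /\ ae_eq g h).
  apply/funext => h; apply/propext; split=> -[dh H]; split=> //.
    by apply: ae_sub ((ae_and _ _).2 (conj fg H)) => t [->].
  by apply: ae_sub ((ae_and _ _).2 (conj fg H)) => t [->].
by move=> H H'; rewrite (Prop_irrelevance H H').
Qed.

(* The elements of the ultrapower are the canonical representatives of the
   classes of definable functions modulo equality almost everywhere. *)
Definition germ := {f : S -> S | exists g (dg : dfun1 g), f = canon dg}.

Definition ev (x : germ) : S -> S := sval x.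

Lemma ev_dfun1 x : dfun1 (ev x).
Proof. by case: x => f H; case: (H) => g [dg E]; rewrite /ev /= E; exact: (canonP dg).1. Qed.

Lemma germ_eqP x y : x = y <-> U (fun t => ev x t = ev y t).
Proof.
split=> [->|]; first exact: aeT.
case: x y => [f Hf] [f' Hf'] /= H.
suff E : f = f' by subst f'; rewrite (Prop_irrelevance Hf Hf').
case: Hf Hf' => g [dg fE] [g' [dg' fE']]; subst; apply: canon_eq.
have := (ae_and _ _).2 (conj H ((ae_and _ _).2
  (conj (canonP dg).2 (canonP dg').2))).
by apply: ae_sub => t [E [-> ->]].
Qed.

Definition mk f (df : dfun1 f) : germ :=
  exist _ (canon df) (ex_intro _ f (ex_intro _ df erefl)).

Lemma mkP f (df : dfun1 f) : U (fun t => ev (mk df) t = f t).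
Proof. by apply: ae_sub (canonP df).2 => t ->. Qed.

(** The existential case of Łoś's theorem: definable choice makes the witnesses into one germ. *)
Lemma ae_ex (Q : S -> S -> Prop) : D2 Q ->
  U (fun t => exists a, Q t a) <-> exists x, U (fun t => Q t (ev x t)).
Proof.
move=> dQ; split=> [UQ|[x]]; last by apply: ae_sub => t ?; exists (ev x t).
have [f df Hf] := choice1 om dQ; exists (mk df).
by apply: ae_sub ((ae_and _ _).2 (conj UQ (mkP df))) => t [/Hf Qt ->].
Qed.

Lemma ae_all (Q : S -> S -> Prop) : D2 Q ->
  U (fun t => forall a, Q t a) <-> forall x, U (fun t => Q t (ev x t)).
Proof.
move=> dQ; split=> [UQ x|UQ]; first by apply: ae_sub UQ.
apply: contrapT => /ae_not nU.
have /ae_ex : D2 (fun t a => ~ Q t a) by dfn.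
case=> + _; case=> [|x /ae_not]; last by apply.
by apply: ae_sub nU => t /existsNP.
Qed.

Lemma ae_card_le n (X : S -> S -> Prop) : D2 X ->
  U (fun t => card_le n (X t)) <-> card_le n (fun x => U (fun t => X t (ev x t))).
Proof.
have dev := ev_dfun1.
elim: n X => [|n IH] X dX /=.
  rewrite ae_all; last by dfn.
  by split=> H x; have := H x; rewrite ae_not.
rewrite ae_ex; last by dfn.
have E y : U (fun t => card_le n (fun x => X t x /\ x <> ev y t)) <->
    card_le n (fun x => U (fun t => X t (ev x t)) /\ x <> y).
  rewrite (IH (fun t x => X t x /\ x <> ev y t)); last by dfn.
  rewrite (_ : (fun x => U _) = (fun x => U (fun t => X t (ev x t)) /\ x <> y)) //.
  by apply/funext => x; apply/propext; rewrite ae_and ae_not germ_eqP.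
by split=> -[y /E]; exists y.
Qed.

Definition germ_lt (x y : germ) := U (fun t => ev x t ≺ ev y t).

(** The variable [None] of Q stands for the index t. As Q may depend on it, every germ is definable
    as a constant, which [om_cst] requires. *)
Definition germ_D (W : finType) (P : (W -> germ) -> Prop) :=
  exists2 Q : (option W -> S) -> Prop, D Q &
    forall e, P e <-> U (fun t => Q (oapp (fun w => ev (e w) t) t)).

Lemma dfun1_id : dfun1 (fun t : S => t).
Proof. exact: D_eq2. Qed.

Lemma D2_germs (W : finType) (Q : (option (option W) -> S) -> Prop)
    (e : W -> germ) : D Q ->
  D2 (fun t a => Q (oapp (oapp (fun w => ev (e w) t) a) t)).
Proof.
move=> dQ; pose r (o : option (option W)) (d : bool -> S) :=
  oapp (oapp (fun w => ev (e w) (d true)) (d false)) (d true) o.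
have dr o : dfun (r o).
  case: o => [[w|]|]; last exact: (dfun_var S true).
    exact: (dfun_app (ev_dfun1 (e w)) (dfun_var S true)).
  exact: (dfun_var S false).
have := D_subst dQ dr; apply: D_ext => d.
by rewrite (_ : (fun w => r w d) =
  oapp (oapp (fun w => ev (e w) (d true)) (d false)) (d true)).
Qed.

Lemma oapp_oapp (W : Type) (e : option W -> germ) t :
  (fun w => ev (e w) t) = oapp (fun w => ev (e (Some w)) t) (ev (e None) t).
Proof. by apply/funext => -[]. Qed.

Definition ultrapower : dstr.
Proof.
refine (@Dstr germ (mk dfun1_id) germ_lt _ _ _ _ _ _ germ_D _ _ _ _ _ _).
- by move=> x; apply/ae_not; apply: aeT => t; apply: lt_irr.
- move=> y x z xy yz.
  by apply: ae_sub ((ae_and _ _).2 (conj xy yz)) => t []; apply: lt_trans.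
- move=> x y; have [xy|nxy] := pselect (germ_lt x y); first by left.
  have [yx|nyx] := pselect (germ_lt y x); first by right; right.
  right; left; apply/germ_eqP.
  apply: ae_sub ((ae_and _ _).2 (conj ((ae_not _).2 nxy) ((ae_not _).2 nyx))).
  by move=> t [? ?]; apply: le_anti.
- have dev := ev_dfun1.
  move=> x y xy; have [|z /ae_and Uz] := (ae_ex (Q := fun t a =>
    ev x t ≺ a /\ a ≺ ev y t) _).1 (ae_sub (fun t => @dense S _ _) xy).
    by dfn.
  by exists z.
- have dev := ev_dfun1.
  move=> x; apply/(ae_ex (Q := fun t a => a ≺ ev x t)); first by dfn.
  by apply: aeT => t; apply: unbounded_l.
- have dev := ev_dfun1.
  move=> x; apply/(ae_ex (Q := fun t a => ev x t ≺ a)); first by dfn.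
  by apply: aeT => t; apply: unbounded_r.
- move=> W P1 P2 [Q1 dQ1 E1] [Q2 dQ2 E2].
  exists (fun e => Q1 e /\ Q2 e); first exact: D_and.
  by move=> e; rewrite ae_and -E1 -E2.
- move=> W P [Q dQ E]; exists (fun e => ~ Q e); first exact: D_not.
  by move=> e; rewrite ae_not -E.
- move=> W P [Q dQ E].
  exists (fun e => exists a, Q (oapp (oapp (fun w => e (Some w)) a) (e None))).
    apply: (D_ex (Q := fun e a => Q (oapp (oapp (fun w => e (Some w)) a) (e None)))).
    have := D_rename (@swap W) dQ; apply: D_ext => e.
    rewrite (_ : (fun w => e (swap w)) =
      oapp (oapp (fun w => e (Some (Some w))) (e None)) (e (Some None))) //.
    by apply/funext => -[[]|].
  move=> e; rewrite (ae_ex (D2_germs e dQ)).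
  split=> -[x Hx]; exists x.
    by apply: ae_sub ((E (oapp e x)).1 Hx) => t; rewrite oapp_oapp.
  by apply/(E (oapp e x)); apply: ae_sub Hx => t; rewrite oapp_oapp.
- move=> W W' r P [Q dQ E].
  exists (fun e => Q (oapp (fun w => e (Some (r w))) (e None))).
    exact: D_rename_oapp.
  by move=> e; rewrite E.
- exists (fun e : option bool -> S => e (Some true) ≺ e (Some false)) => //.
  exact: (D_lt (dfun_var S (Some true)) (dfun_var S (Some false))).
- exists (fun e : option bool -> S => e (Some true) = e (Some false)).
    exact: (D_eq (dfun_var S (Some true)) (dfun_var S (Some false))).
  by move=> e; rewrite germ_eqP.
Defined.

Lemma ae_bp (Q : S -> S -> Prop) (x : ultrapower) : D2 Q ->
  U (fun t => bp (Q t) (ev x t)) <->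
  bp (fun y : ultrapower => U (fun t => Q t (ev y t))) x.
Proof.
move=> dQ; have dev := ev_dfun1.
rewrite /bp ae_not /near ae_ex; last by dfn.
split=> nU [u Hu]; apply: nU; exists u.
  case: Hu => v [ux [xv Huv]]; apply/(ae_ex (Q := fun t v => ev u t ≺ ev x t /\
    ev x t ≺ v /\ (forall s, ev u t ≺ s -> s ≺ v -> Q t s <-> Q t (ev x t)))).
    by dfn.
  exists v; rewrite !ae_and; split=> //; split=> //.
  rewrite ae_all; last by dfn.
  by move=> y; rewrite !ae_imp => uy yv; rewrite ae_iff; apply: Huv.
move: Hu; rewrite ae_ex; last by dfn.
case=> v; rewrite !ae_and ae_all; last by dfn.
move=> [ux [xv Huv]]; exists v; split=> //; split=> // y uy yv.
by move: (Huv y); rewrite !ae_imp ae_iff; apply.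
Qed.

Lemma germ_D1 (Q : (option unit -> S) -> Prop) :
  D Q -> D2 (fun t a => Q (oapp (fun _ : unit => a) t)).
Proof.
move=> dQ; have := D_rename (oapp (fun _ : unit => false) true) dQ.
apply: D_ext => e.
by rewrite (_ : (fun w => e _) = oapp (fun=> e false) (e true)) //;
  apply/funext => -[].
Qed.

(** A bound on breakpoints passes to the ultrapower only if it is common to all t, whence the use of
    [uniform_finiteness1] for [om_fin]. For [om_const], a change of P between x and y produces
    breakpoints for almost all t, and choice turns these into a breakpoint germ. *)
Lemma omin_ultrapower : omin ultrapower.
Proof.
have dev := ev_dfun1; split.
- move=> a; exists (fun e : option unit -> S => e (Some tt) = ev a (e None)).
    exact: (D_eq (dfun_var S (Some tt)) (dfun_app (dev a) (dfun_var S None))).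
  by move=> e; rewrite germ_eqP.
- move=> W P [Q dQ E].
  pose Q' (e : option (option W) -> S) := Q (fun o => e (swap o)).
  have [F dF HF] := om_choice om (D_rename (@swap W) dQ : D Q').
  pose f (e : W -> germ) t := F (oapp (fun w => ev (e w) t) t).
  have df e : dfun1 (f e).
    have dg (o : option W) : dfun1 (fun t => oapp (fun w => ev (e w) t) t o).
      by case: o => [w|] /=; [exact: dev|exact: D_eq2].
    exact: (dfun1_comp dF dg).
  exists (fun e => mk (df e)).
    exists (fun e : option (option W) -> S =>
        e (Some None) = F (oapp (fun w => e (Some (Some w))) (e None))).
      have := D_rename (@swap W) dF; apply: D_ext => e.
      rewrite (_ : (fun w => e (swap (Some w))) =
        oapp (fun w => e (Some (Some w))) (e None)) //.
      by apply/funext => -[].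
    move=> e; rewrite germ_eqP.
    have M := mkP (df (fun w => e (Some w))).
    split=> H; apply: ae_sub ((ae_and _ _).2 (conj H M)) => t [/=].
      by move=> -> ->.
    by move=> -> ->.
  have Esw e x t : (fun w => oapp (oapp (fun w => ev (e w) t) t) (ev x t)
      (@swap W w)) = oapp (fun w => ev (oapp e x w) t) t :> (_ -> S).
    by apply/funext => -[[]|].
  move=> e [x /E H]; apply/E.
  have := (ae_and _ _).2 (conj H (mkP (df e))).
  apply: ae_sub => t [Qx mE].
  have := HF (oapp (fun w => ev (e w) t) t).
  rewrite -[F _]mE /Q' Esw; apply; exists (ev x t).
  by rewrite Esw.
- move=> P [Q /germ_D1 dR E]; pose R t a := Q (oapp (fun _ : unit => a) t).
  rewrite -/R in dR E.
  have [||N HN] := uniform_finiteness1 om (A := fun t => bp (R t)).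
  - by rewrite /bp; dfn.
  - by move=> t; apply: (om_fin om); dfn.
  have dB : D2 (fun t => bp (R t)) by rewrite /bp; dfn.
  have H := (ae_card_le N dB).1 (aeT HN).
  exists N; apply: (@card_le_sub ultrapower N _ _ _ H) => x bx.
  apply/(ae_bp x dR).
  rewrite (_ : (fun y => U _) = P) //.
  by apply/funext => y; apply/propext; have := E (fun _ => y); tauto.
- move=> P [Q /germ_D1 dR E] x y xy nbp.
  pose R t a := Q (oapp (fun _ : unit => a) t); rewrite -/R in dR E.
  have dB : D2 (fun t => bp (R t)) by rewrite /bp; dfn.
  have Px z : P z <-> U (fun t => R t (ev z t)) by exact: (E (fun _ => z)).
  have PE : (fun z : ultrapower => U (fun t => R t (ev z t))) = P.
    by apply/funext => z; apply/propext; rewrite Px.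
  rewrite !Px -ae_iff; apply: contrapT => /ae_not nU.
  have : U (fun t => exists z, (ev x t ≼ z /\ z ≼ ev y t) /\ bp (R t) z).
    apply: ae_sub ((ae_and _ _).2 (conj xy nU)) => t [xyt nQ].
    apply: contrapT => nz; apply: nQ.
    have dRt : D1 (R t) by dfn.
    apply: (om_const om dRt xyt) => z xz zy bz.
    by apply: nz; exists z.
  rewrite ae_ex; last by dfn.
  case=> z /ae_and[/ae_and[/ae_not xz /ae_not zy]] /(ae_bp z dR).
  by rewrite PE; apply: nbp.
Qed.

End Ultrapower.

(** The structure varies in the induction, since the induction hypothesis is applied to an
    ultrapower. *)
Lemma uniform_finiteness_vars k (S : dstr) (P : (vars k.+1 -> S) -> Prop) :
  omin S -> D P ->
  exists N, forall e : vars k -> S, card_le N (bp (fun x => P (oapp e x))).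
Proof.
elim: k S P => [|k IH] S P om dP.
  have [|N HN] := om_fin om (P := fun x => P (fun _ => x)).
    have := D_rename (fun _ : vars 1 => tt) dP; exact.
  exists N => e; rewrite (_ : (fun x => P _) = (fun x => P (fun _ => x))) //.
  by apply/funext => x; congr P; apply/funext => -[[]|].
apply: contrapT => nN.
pose Bd N t (e : vars k -> S) := card_le N (bp (fun x => P (oapp (oapp e t) x))).
pose B N : set S := fun t => exists e, ~ Bd N t e.
have Bmono N N' t e : N <= N' -> Bd N t e -> Bd N' t e.
  by move=> NN'; apply: (card_le_weak (pt S) NN').
have B0 N : exists t, B N t.
  apply: contrapT => nt; apply: nN; exists N => e; apply: contrapT => ne.
  apply: nt; exists (e None), (fun w => e (Some w)).
  by rewrite /Bd (oapp_eta e).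
(* The sets [B N] decrease with N and are non-empty, so they generate a proper filter. *)
pose F : set_system S := fun X => exists N, (B N `<=` X)%classic.
have FF : ProperFilter F.
  split=> [[N BN]|]; first by have [t /BN] := B0 N.
  split=> [|X Y [N BX] [N' BY]|X Y XY [N BX]].
  - by exists 0.
  - exists (maxn N N') => t [e nB]; split.
      by apply: BX; exists e => /Bmono bd; apply: nB; apply: bd; rewrite leq_maxl.
    by apply: BY; exists e => /Bmono bd; apply: nB; apply: bd; rewrite leq_maxr.
  - by exists N => t /BX /XY.
have [U [UU FU]] := ultraFilterLemma FF.
pose P' (e : vars k.+1 -> ultrapower om UU) :=
  U (fun t => P (oapp (oapp (fun w => ev (e (Some w)) t) t) (ev (e None) t))).
have dP' : D P'.
  exists (fun e => P (fun o => e (@swap (vars k) o))).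
    exact: (D_rename (@swap (vars k)) dP).
  move=> e; rewrite /P'; apply: ae_ext => t.
  rewrite (_ : (fun o => _) =
    oapp (oapp (fun w => ev (e (Some w)) t) t) (ev (e None) t)) //.
  by apply/funext => -[[]|].
have [N HN] := IH _ P' (omin_ultrapower om UU) dP'.
have UB : U (B N) by apply: FU; exists N.
(* For t in [B N], the tuple G t exceeds the very bound N that holds in the ultrapower; the bound,
   applied to the germs of its coordinates, is contradicted at almost every t. *)
have [|G dG HG] := choice_vars (Q := fun t e => ~ Bd N t e) om.
  apply: D_not; have := D_card_bp N dP; apply: D_ext => e.
  by rewrite /Bd (oapp_eta e).
pose g w := mk UU (dG w).
have Ug w : U (fun t => ev (g w) t = G t w) by exact: mkP.
have := HN g.
pose R t a := P (oapp (oapp (fun w => ev (g w) t) t) a).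
have dR : D2 R.
  have := D2_germs g (D_rename (@swap (vars k)) dP).
  apply: D_ext => e; rewrite /R (_ : (fun w => _) = oapp (oapp (fun w =>
    ev (g w) (e true)) (e true)) (e false)) //.
  by apply/funext => -[[]|].
have dB : D2 (fun t => bp (R t)) by rewrite /bp; dfn.
have -> : bp (fun x : ultrapower om UU => P' (oapp g x)) =
    (fun x : germ UU => U (fun t => bp (R t) (ev x t))).
  by apply/funext => x; apply/propext; rewrite (ae_bp x dR).
rewrite -(ae_card_le om UU N dB) => UN.
have Uall : U (fun t => forall w, ev (g w) t = G t w).
  suff H (l : seq (vars k)) : U (fun t => forall w, w \in l -> ev (g w) t = G t w).
    by apply: ae_sub (H (enum (vars k))) => t Ht w; apply: Ht; rewrite mem_enum.
  elim: l => [|w l IHl]; first exact: aeT.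
  apply: ae_sub ((ae_and UU _ _).2 (conj (Ug w) IHl)) => t [Ew El] w'.
  by rewrite inE => /predU1P[->|/El].
have := (ae_and UU _ _).2 (conj UB ((ae_and UU _ _).2 (conj UN Uall))).
move=> /(@filter_ex _ _ (@ultra_proper _ _ UU))[t [/HG nBd [bd Et]]].
apply: nBd; rewrite /Bd; rewrite (_ : G t = (fun w => ev (g w) t)) //.
by apply/funext => w; rewrite Et.
Qed.

(** * Definability by formulas *)

Lemma finite_bigcup (T T' : Type) (X : T -> Prop) (Y : T -> T' -> Prop) :
    finite_pred X -> (forall x, X x -> finite_pred (Y x)) ->
  finite_pred (fun y => exists x, X x /\ Y x y).
Proof.
elim/finite_ind => {}X; first by move=> X0 _; exists 0 => y [x [/X0]].
move=> x Xx IH Yfin; apply: finite_sub (finiteU (IH _) (Yfin x Xx)) => [y|z [Xz _]].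
  move=> [z [Xz Yzy]]; have [<-|zx] := pselect (z = x); first by right.
  by left; exists z.
exact: Yfin.
Qed.

Lemma finite1 (T : Type) (x : T) : finite_pred (fun y => y = x).
Proof. by exists 1, x => y []. Qed.

Lemma finite_seq (T : eqType) (s : seq T) : finite_pred (fun x => x \in s).
Proof.
elim: s => [|x s IH]; first by exists 0.
apply: finite_sub (finiteU (finite1 x) IH) => y.
by rewrite inE => /predU1P.
Qed.

Lemma card_vars k : #|vars k| = k.
Proof. by elim: k => [|k IH]; rewrite ?card_void ?card_option ?IH. Qed.

Lemma uniform_finiteness (S : dstr) (W : finType) (P : (option W -> S) -> Prop) :
  omin S -> D P ->
  exists N, forall e : W -> S, card_le N (bp (fun x => P (oapp e x))).
Proof.
move=> om dP.
pose r (w : W) : vars #|W| :=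
  enum_val (cast_ord (esym (card_vars #|W|)) (enum_rank w)).
pose r' (v : vars #|W|) : W := enum_val (cast_ord (card_vars #|W|) (enum_rank v)).
have rK : cancel r r' by move=> w; rewrite /r' /r enum_valK cast_ordKV enum_rankK.
have [N HN] := uniform_finiteness_vars om (D_rename (omap r) dP).
exists N => e; have := HN (fun v => e (r' v)).
rewrite (_ : (fun x => _) = (fun x => P (oapp e x))) //.
apply/funext => x; congr P; apply/funext => -[w|] //=.
by rewrite rK.
Qed.

(** * Finite sets between whose points a predicate is constant *)

Section BreakpointsSuffice.
Variable S : dstr.
Implicit Types (P X : S -> Prop) (x y z : S).

Definition separates X P :=
  forall x y, x ≺ y -> (forall z, x ≼ z -> z ≼ y -> ~ X z) -> (P x <-> P y).

(** Points of X that are not breakpoints are discarded one by one: P is constant around such a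
    point, hence agrees on its two sides. *)
Lemma bp_separates X P : finite_pred X -> separates X P -> separates (bp P) P.
Proof.
move=> Xfin sepX a b ab nbp.
have: forall x y, a ≼ x -> x ≺ y -> y ≼ b ->
    (forall z, x ≼ z -> z ≼ y -> ~ X z) -> (P x <-> P y).
  by move=> *; apply: sepX.
elim/finite_ind: Xfin {sepX} => {}X.
  by move=> X0; apply=> //; order.
move=> c Xc IH sepX; apply: IH => x y ax xy yb nX.
have [[xc cy]|ncxy] := pselect (x ≼ c /\ c ≼ y); last first.
  apply: sepX => // z xz zy Xz; apply: (nX z xz zy); split=> // zc.
  by apply: ncxy; rewrite -zc.
have /contrapT [u [v [uc [cv Pc]]]] : ~ bp P c by apply: nbp; order.
have Px : P x <-> P c.
  case: (lt_total x c) => [lt|[->//|/xc//]].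
  have [m [um [xm mc]]] := between_max uc lt.
  have Pm : P x <-> P m.
    apply: sepX => //; first by order.
    move=> z xz zm Xz; apply: (nX z xz); first by order.
    by split=> // zc; subst z.
  by rewrite Pm; apply: Pc => //; order.
have Py : P y <-> P c.
  case: (lt_total c y) => [lt|[->//|/cy//]].
  have [m [cm [mv my]]] := between_min cv lt.
  have Pm : P m <-> P y.
    apply: sepX => //; first by order.
    move=> z mz zy Xz; apply: (nX z _ zy); first by order.
    by split=> // zc; subst z; order.
  by rewrite -Pm; apply: Pc => //; order.
by rewrite Px Py.
Qed.

Lemma separates_bp X P : finite_pred X -> separates X P -> finite_pred (bp P).
Proof.
move=> Xfin sepX; apply: finite_sub (Xfin) => x; apply: contraPP => nXx; apply.
have [u ux nXl] := finite_free_l x Xfin; have [v xv nXr] := finite_free_r x Xfin.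
exists u, v; split=> //; split=> // y uy yv.
have nX z : u ≺ z -> z ≺ v -> ~ X z.
  by move=> uz zv; case: (lt_total z x) => [?|[->|?]];
    [apply: nXl|apply: nXx|apply: nXr].
case: (lt_total x y) => [lt|[->//|lt]]; last first.
  by apply: sepX => // z *; apply: nX; order.
by apply: iff_sym; apply: sepX => // z *; apply: nX; order.
Qed.

End BreakpointsSuffice.

(** * Adjoining constants to a structure *)

Section Constants.
Variable S : dstr.

Definition glue (W V : Type) (e : W -> S) (b : V -> S) (o : W + V) : S :=
  match o with inl w => e w | inr v => b v end.

Definition cD (W : finType) (P : (W -> S) -> Prop) :=
  exists (V : finType) (Q : (W + V -> S) -> Prop) (b : V -> S),
    D Q /\ forall e, P e <-> Q (glue e b).

Definition with_constants : dstr.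
Proof.
refine (@Dstr S (pt S) (@lt S) (@lt_irr S) (@lt_trans S) (@lt_total S)
  (@dense S) (@unbounded_l S) (@unbounded_r S) cD _ _ _ _ _ _).
- move=> W P1 P2 [V1 [Q1 [b1 [dQ1 E1]]]] [V2 [Q2 [b2 [dQ2 E2]]]].
  pose r1 (o : W + V1) : W + (V1 + V2) :=
    match o with inl w => inl w | inr v => inr (inl v) end.
  pose r2 (o : W + V2) : W + (V1 + V2) :=
    match o with inl w => inl w | inr v => inr (inr v) end.
  exists (V1 + V2 : finType)%type,
    (fun e => Q1 (fun o => e (r1 o)) /\ Q2 (fun o => e (r2 o))), (glue b1 b2).
  split; first exact: (D_and (D_rename r1 dQ1) (D_rename r2 dQ2)).
  move=> e; rewrite E1 E2.
  rewrite (_ : (fun o => glue e (glue b1 b2) (r1 o)) = glue e b1); last first.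
    by apply/funext => -[].
  by rewrite (_ : (fun o => glue e (glue b1 b2) (r2 o)) = glue e b2) //;
    apply/funext => -[].
- move=> W P [V [Q [b [dQ E]]]]; exists V, (fun e => ~ Q e), b.
  by split=> [|e]; [exact: D_not|rewrite E].
- move=> W P [V [Q [b [dQ E]]]].
  pose r (o : option W + V) : option (W + V) :=
    match o with inl w => omap inl w | inr v => Some (inr v) end.
  exists V, (fun e => exists a, Q (fun o => oapp e a (r o))), b.
  split; first exact: D_exists (D_rename r dQ).
  have rE e a : (fun o => oapp (glue e b) a (r o)) = glue (oapp e a) b.
    by apply/funext => -[[]|].
  by move=> e; split=> -[a] Ha; exists a; move: Ha; rewrite rE E.
- move=> W W' r P [V [Q [b [dQ E]]]].
  pose r' (o : W + V) : W' + V :=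
    match o with inl w => inl (r w) | inr v => inr v end.
  exists V, (fun e => Q (fun o => e (r' o))), b.
  split; first exact: D_rename.
  move=> e; rewrite E (_ : (fun o => glue e b (r' o)) = glue (fun w => e (r w)) b) //.
  by apply/funext => -[].
- exists void, (fun e => e (inl true) ≺ e (inl false)), (of_void S).
  by split=> //; exact: (D_lt (dfun_var S (inl true)) (dfun_var S (inl false))).
- exists void, (fun e => e (inl true) = e (inl false)), (of_void S).
  by split=> //; exact: (D_eq (dfun_var S (inl true)) (dfun_var S (inl false))).
Defined.

Lemma D_with_constants (W : finType) (P : (W -> S) -> Prop) :
  D P -> @D with_constants W P.
Proof.
move=> dP; exists void, (fun e => P (fun w => e (inl w))), (of_void S).
by split=> //; exact: D_rename.
Qed.

Lemma cst_with_constants (a : S) : @D1 with_constants (fun x => x = a).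
Proof.
exists unit, (fun e => e (inl tt) = e (inr tt)), (fun _ => a).
by split=> //; exact: (D_eq (dfun_var S (inl tt)) (dfun_var S (inr tt))).
Qed.

End Constants.

(** * Definability by formulas in R, and definable choice *)

Section Formulas.
Variable L : language.

Fixpoint tren (V V' : Type) (r : V -> V') (t : term L V) : term L V' :=
  match t with
  | Var v => Var L (r v)
  | App n f ts => App f (fun i => tren r (ts i))
  end.

Fixpoint fren (V V' : Type) (r : V -> V') (f : formula L V) : formula L V' :=
  match f with
  | Bot => Bot L V'
  | Eq t u => Eq (tren r t) (tren r u)
  | Rel n p ts => Rel p (fun i => tren r (ts i))
  | Not g => Not (fren r g)
  | And g h => And (fren r g) (fren r h)
  | Or g h => Or (fren r g) (fren r h)
  | Imp g h => Imp (fren r g) (fren r h)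
  | Exists g => Exists (fren (omap r) g)
  | Forall g => Forall (fren (omap r) g)
  end.

Variables (R : rcfType) (M : structure L R).

Lemma eval_tren V V' (r : V -> V') (e : V' -> R) t :
  eval M e (tren r t) = eval M (fun v => e (r v)) t.
Proof.
elim: t => [//|n f ts IH] /=; congr (fint _ _ _).
by apply/ffunP => i; rewrite !ffunE.
Qed.

Lemma holds_fren V V' (r : V -> V') (e : V' -> R) f :
  holds M e (fren r f) <-> holds M (fun v => e (r v)) f.
Proof.
have omapE W W' (r0 : W -> W') (e0 : W' -> R) a :
    (fun v => oapp e0 a (omap r0 v)) = oapp (fun v => e0 (r0 v)) a.
  by apply/funext => -[].
elim: f V' r e => {V} /= V.
- by [].
- by move=> t u V' r e; rewrite !eval_tren.
- move=> n p ts V' r e; rewrite (_ : [ffun i => _] =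
    [ffun i => eval M (fun v => e (r v)) (ts i)]) //.
  by apply/ffunP => i; rewrite !ffunE eval_tren.
- by move=> g IH V' r e; rewrite IH.
- by move=> g IHg h IHh V' r e; rewrite IHg IHh.
- by move=> g IHg h IHh V' r e; rewrite IHg IHh.
- by move=> g IHg h IHh V' r e; rewrite IHg IHh.
- by move=> g IH V' r e; split=> -[a Ha]; exists a; move: Ha; rewrite IH omapE.
- by move=> g IH V' r e; split=> Ha a; move: (Ha a); rewrite IH omapE.
Qed.

Definition fdef (W : finType) (P : (W -> R) -> Prop) :=
  exists f : formula L W, forall e, P e <-> holds M e f.

Hypothesis hfield : expands_ordered_field M.

Definition reals : dstr.
Proof.
refine (@Dstr R 0%R (fun x y => (x < y)%R) _ _ _ _ _ _ fdef _ _ _ _ _ _).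
- by move=> x; rewrite Order.POrderTheory.ltxx.
- by move=> y x z; apply: Order.POrderTheory.lt_trans.
- move=> x y; case: (Order.TotalTheory.ltgtP x y) => ?; [left|right; right|right; left] => //.
- move=> x y xy; exists ((x + y) / 2%:R)%R.
  by rewrite (Num.Theory.midf_lt xy).1 (Num.Theory.midf_lt xy).2.
- by move=> x; exists (x - 1)%R; rewrite Num.Theory.ltrBlDr Num.Theory.ltrDl Num.Theory.ltr01.
- by move=> x; exists (x + 1)%R; rewrite Num.Theory.ltrDl Num.Theory.ltr01.
- by move=> W P Q [f Ef] [g Eg]; exists (And f g) => e /=; rewrite Ef Eg.
- by move=> W P [f Ef]; exists (Not f) => e /=; rewrite Ef.
- by move=> W P [f Ef]; exists (Exists f) => e /=;
    split=> -[a] Ha; exists a; move: Ha; rewrite Ef.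
- by move=> W W' r P [f Ef]; exists (fren r f) => e; rewrite holds_fren Ef.
- case: hfield => _ _ [_ _ _ [r Er]].
  exists (Rel r (fun i : 'I_2 => Var L (i == ord0))) => e /=.
  by rewrite Er !ffunE.
- by exists (Eq (Var L true) (Var L false)).
Defined.

Definition creals : dstr := with_constants reals.

Lemma D3_add : @D3 reals (fun z x y => z = x + y)%R.
Proof.
case: hfield => _ _ [_ [p Ep] _ _].
exists (Eq (Var L None) (App p (fun i : 'I_2 => Var L (Some (i == ord0))))).
by move=> e /=; rewrite Ep !ffunE.
Qed.

Hypothesis homin : o_minimal M.

(** X consists of the finite endpoints of the intervals given by o-minimality. The constants of P
    are enumerated first, to fit the shape of [o_minimal]. *)
Lemma creals_separates (P : creals -> Prop) : D1 P ->
  exists2 X : creals -> Prop, finite_pred X & separates X P.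
Proof.
move=> [V [Q [b [[f Ef] E]]]].
pose r (o : unit + V) : 'I_1 + 'I_#|V| :=
  match o with inl _ => inl ord0 | inr v => inr (enum_rank v) end.
pose b' := [ffun i : 'I_#|V| => b (enum_val i)].
have [s Es] := homin (fren r f) b'.
have Ps (a : R) : P a <-> has (fun i => a \in i) s.
  rewrite (E (fun _ => a)) Ef; have /(congr1 (fun A : set R => A a)) := Es.
  rewrite /defset /= (propext (holds_fren _ _ _)) => <-.
  suff -> : glue (S := reals) (fun=> a) b = (fun v : unit + V =>
    match r v with inl i => [ffun=> a : R] i | inr w => b' w end) by [].
  by apply/funext => -[[]|v] /=; rewrite ffunE ?enum_rankK.
pose bnd (i : itv_bound R) := if i is BSide _ x then [:: x] else [::].
pose ends := flatten [seq bnd (let: Interval l _ := i in l) ++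
                          bnd (let: Interval _ u := i in u) | i <- s].
exists (fun x => x \in ends); first exact: finite_seq.
move=> x y xy nends.
suff: has (fun i => x \in i) s = has (fun i => y \in i) s.
  by move=> H; rewrite !Ps H.
have {}xy : (x < y)%R := xy.
have {}nends z : (x <= z)%R -> (z <= y)%R -> z \notin ends.
  move=> xz zy; apply/negP; apply: nends; apply/negP; by rewrite -Order.TotalTheory.leNgt.
apply: eq_in_has => -[l u] is_.
have nl z : z \in bnd l ++ bnd u -> (z < x)%R \/ (y < z)%R.
  move=> zi; have zends : z \in ends.
    apply/flattenP; exists (bnd l ++ bnd u) => //.
    by apply/mapP; exists (Interval l u).
  case: (Order.TotalTheory.leP x z) => [xz|]; last by left.
  case: (Order.TotalTheory.leP z y) => [zy|]; last by right.
  by have := nends z xz zy; rewrite zends.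
rewrite !itv_boundlr; congr (_ && _).
  case: l nl {is_} => [c z|c] // nl.
  have [zx|yz] : (z < x)%R \/ (y < z)%R by apply: nl; rewrite mem_cat inE eqxx.
    have zy := Order.POrderTheory.lt_trans zx xy.
    by case: c {nl}; rewrite !bnd_simp ?zx ?zy
    ?(Order.POrderTheory.ltW zx) ?(Order.POrderTheory.ltW zy).
  have xz := Order.POrderTheory.lt_trans xy yz.
  by case: c {nl}; rewrite !bnd_simp
    ?(Order.POrderTheory.lt_geF xz) ?(Order.POrderTheory.lt_geF yz)
    ?(Order.POrderTheory.lt_gtF xz) ?(Order.POrderTheory.lt_gtF yz).
case: u nl {is_} => [c z|c] // nl.
have [zx|yz] : (z < x)%R \/ (y < z)%R by apply: nl; rewrite mem_cat inE eqxx orbT.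
  have zy := Order.POrderTheory.lt_trans zx xy.
  by case: c {nl}; rewrite !bnd_simp
    ?(Order.POrderTheory.lt_geF zx) ?(Order.POrderTheory.lt_geF zy)
    ?(Order.POrderTheory.lt_gtF zx) ?(Order.POrderTheory.lt_gtF zy).
have xz := Order.POrderTheory.lt_trans xy yz.
by case: c {nl}; rewrite !bnd_simp ?xz ?yz
    ?(Order.POrderTheory.ltW xz) ?(Order.POrderTheory.ltW yz).
Qed.

Lemma dfun_add (W : finType) (t1 t2 : (W -> creals) -> creals) :
  dfun t1 -> dfun t2 ->
  dfun (fun e => ((t1 e : R) + (t2 e : R))%R : creals).
Proof.
move=> /dfun_weak dt1 /dfun_weak dt2.
exact: (D3_app (D_with_constants D3_add : @D3 creals _) (dfun_var _ None) dt1 dt2).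
Qed.

(** A finite set, definable uniformly in X, that meets X unless X is empty: 0, the breakpoints,
    their translates by 1 in both directions, and their midpoints. The equations are arranged so
    that addition suffices to write them. *)
Definition candidate (X : creals -> Prop) (c : R) :=
  (c = 0 \/ (exists b : R, @bp creals X b /\ (c = b \/ c = b + 1 \/ b = c + 1)) \/
  (exists b b' : R, @bp creals X b /\ @bp creals X b' /\ c + c = b + b'))%R.

Lemma candidate_finite X : D1 X -> finite_pred (candidate X).
Proof.
move=> dX; have [Y Yfin sepY] := creals_separates dX.
have bfin := separates_bp Yfin sepY.
apply: finiteU; first exact: finite1.
apply: finiteU.
  apply: (finite_bigcup (Y := fun b c : R => c = b \/ c = b + 1 \/ b = c + 1)%R) => // b _.
  apply: finiteU; first exact: finite1.
  apply: finiteU; first exact: finite1.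
  by apply: finite_sub (finite1 (b - 1)%R) => c ->; rewrite GRing.addrK.
apply: finite_sub (finite_bigcup bfin (Y := fun b (c : R) => exists b', bp X b' /\
    c = ((b + b') / 2%:R)%R) _) => [c [b [b' [? [? cE]]]]|b _].
  exists b; split=> //; exists b'; split=> //; rewrite -cE.
  by rewrite GRing.mulrDl -Num.Theory.splitr.
by apply: finite_bigcup => // b' _; apply: finite1.
Qed.

(** A point of X that is not a breakpoint may be moved within its gap: to the midpoint of a bounded
    gap, to distance 1 from the end of a half-bounded one, to 0 if there are no breakpoints. *)
Lemma candidate_meets (X : creals -> Prop) : D1 X -> (exists x, X x) ->
  exists c, X c /\ candidate X c.
Proof.
move=> dX [x Xx]; have [Y Yfin sepY] := creals_separates dX.
have bfin := separates_bp Yfin sepY; have sep := bp_separates Yfin sepY.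
have [bx|nbx] := pselect (bp X x).
  by exists x; split=> //; right; left; exists x; split=> //; left.
have same c : (forall z, x ≼ z -> z ≼ c -> ~ bp X z) ->
    (forall z, c ≼ z -> z ≼ x -> ~ bp X z) -> X c.
  by move=> H1 H2; case: (lt_total x c) => [lt|[<-//|lt]];
    [apply/(sep _ _ lt)|apply/(sep _ _ lt)].
have lt1 (b : R) : @lt creals b (b + 1)%R.
  by rewrite /= Num.Theory.ltrDl Num.Theory.ltr01.
have lt1' (b : R) : @lt creals (b - 1)%R b.
  by rewrite /= Num.Theory.ltrBlDr Num.Theory.ltrDl Num.Theory.ltr01.
have left_bp : (exists b, (bp X b /\ b ≺ x) /\ forall z, bp X z -> z ≺ x -> z ≼ b) \/
    forall z, bp X z -> x ≼ z.
  have [ex|nex] := pselect (exists b, bp X b /\ b ≺ x).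
    left; have [|b bx maxb] := finite_max _ ex.
      by apply: finite_sub bfin => b [].
    by exists b; split=> // z bz zx; apply: maxb.
  by right=> z bz zx; apply: nex; exists z.
have right_bp : (exists b, (bp X b /\ x ≺ b) /\ forall z, bp X z -> x ≺ z -> b ≼ z) \/
    forall z, bp X z -> z ≼ x.
  have [ex|nex] := pselect (exists b, bp X b /\ x ≺ b).
    left; have [|b bx minb] := finite_min _ ex.
      by apply: finite_sub bfin => b [].
    by exists b; split=> // z bz zx; apply: minb.
  by right=> z bz zx; apply: nex; exists z.
have nz z : bp X z -> z <> x by move=> bz zE; apply: nbx; rewrite -zE.
case: left_bp => [[b [[bb bx] maxb]]|nl]; case: right_bp => [[b' [[bb' xb'] minb]]|nr].
- have bb'lt : ((b : R) < (b' : R))%R := lt_trans bx xb'.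
  pose c : creals := (((b : R) + (b' : R)) / 2%:R)%R.
  have bc : b ≺ c := (Num.Theory.midf_lt bb'lt).1.
  have cb' : c ≺ b' := (Num.Theory.midf_lt bb'lt).2.
  exists c; split.
    apply: same => z xz zc bz; case: (lt_total z x) => [lt|[/(nz z bz)//|lt]].
    + by order.
    + by have ? := minb z bz lt; order.
    + by have ? := maxb z bz lt; order.
    + by order.
  right; right; exists b, b'; do 2 (split=> //).
  by rewrite /c -Num.Theory.splitr.
- exists ((b : R) + 1)%R; have blt := lt1 b; split; last first.
    by right; left; exists b; split=> //; right; left.
  apply: same => z xz zc bz; case: (lt_total z x) => [lt|[/(nz z bz)//|lt]].
  + by order.
  + by have ? := nr z bz; order.
  + by have ? := maxb z bz lt; order.
  + by order.
- exists ((b' : R) - 1)%R; have blt := lt1' b'; split; last first.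
    right; left; exists b'; split=> //; right; right.
    by rewrite GRing.subrK.
  apply: same => z xz zc bz; case: (lt_total z x) => [lt|[/(nz z bz)//|lt]].
  + by order.
  + by have ? := minb z bz lt; order.
  + by have ? := nl z bz; order.
  + by order.
exists (0 : R)%R; split; last by left.
by apply: same => z _ _ bz; case: (lt_total z x) => [lt|[/(nz z bz)//|lt]];
  have ? := nl z bz; have ? := nr z bz; order.
Qed.

Lemma creals_cst (W : finType) (a : creals) : dfun (fun _ : W -> creals => a).
Proof.
exact: (D1_app (cst_with_constants (S := reals) a) (dfun_var creals (@None W))).
Qed.

Lemma creals_section (W : finType) (P : (option W -> creals) -> Prop) e :
  D P -> D1 (fun a => P (oapp e a)).
Proof.
move=> dP; have dv (o : option W) : dfun (fun d : unit -> creals => oapp e (d tt) o).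
  by case: o => [w|]; [exact: creals_cst|exact: (dfun_var creals tt)].
by apply: D_ext (D_subst dP dv) => d; rewrite (_ : (fun w => _) = oapp e (d tt)).
Qed.

(** The chosen value is the least candidate in the section, and 0 if the section is empty. *)
Lemma creals_choice (W : finType) (P : (option W -> creals) -> Prop) : D P ->
  exists2 F : (W -> creals) -> creals, dfun F &
    forall e, (exists a, P (oapp e a)) -> P (oapp e (F e)).
Proof.
move=> dP; have dcst := creals_cst.
pose X (e : W -> creals) a := P (oapp e a).
pose Y e a := X e a /\ candidate (X e) a.
have dX e : D1 (X e) by exact: creals_section.
pose Q e a := Y e a /\ forall b, Y e b -> a ≼ b.
have Quniq e a b : Q e a -> Q e b -> a = b.
  by move=> [Ya mina] [Yb minb]; apply: le_anti; [apply: mina|apply: minb].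
have Qex e : (exists a, X e a) -> exists a, Q e a.
  move=> /(candidate_meets (dX e)) ne.
  have [|a Ya mina] := finite_min _ ne; last by exists a.
  by apply: finite_sub (candidate_finite (dX e)) => a [].
have dY : D (fun e : option W -> creals => Y (fun w => e (Some w)) (e None)).
  have one (W0 : finType) (t : (W0 -> creals) -> creals) : dfun t ->
      dfun (fun e => ((t e : R) + 1)%R : creals).
    by move=> dt; apply: dfun_add => //; apply: dcst.
  rewrite /Y /candidate /X /bp /near; dfn.
  all: try exact: (D_rename_oapp (fun w => _) _ dP).
  all: try by do ?[apply: dfun_var|apply: one|apply: dfun_add|apply: dcst].
have dQ : D (fun e : option W -> creals => Q (fun w => e (Some w)) (e None)).
  rewrite /Q; apply: D_and => //; apply: D_all; apply: D_imp.
    exact: (D_rename (oapp (fun w => Some (Some w)) None) dY).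
  by dfn.
pose F e := if pselect (exists a, Q e a) is left H then sval (cid H) else 0%R : creals.
have FE e a : a = F e <-> Q e a \/ (~ exists b, Q e b) /\ a = (0%R : creals).
  rewrite /F; case: pselect => [H|nH].
    case: cid => b Qb /=; split=> [->|[Qa|[]//]]; first by left.
    exact: Quniq Qa Qb.
  by split=> [->|[Qa|[]//]]; [right|case: nH; exists a].
exists F.
  apply: (D_ext (fun e => iff_sym (FE (fun w => e (Some w)) (e None)))).
  apply: D_or => //; apply: D_and.
    apply: D_not; apply: D_ex.
    exact: (D_rename (oapp (fun w => Some (Some w)) None) dQ).
  apply: D_eq; first exact: dfun_var.
  exact: dcst.
move=> e /Qex[a Qa].
by have /FE[[[]]|[]] := erefl (F e) => //; case; exists a.
Qed.

Lemma omin_creals : omin creals.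
Proof.
split.
- by move=> a; exact: (cst_with_constants (S := reals) a).
- exact: creals_choice.
- by move=> P /creals_separates[X Xfin]; apply: separates_bp.
- by move=> P /creals_separates[X Xfin sepX]; apply: bp_separates Xfin sepX.
Qed.

Lemma fdef_uniform_finiteness (W : finType) (P : (option W -> R) -> Prop) :
  @D reals _ P ->
  exists N, forall e : W -> R, card_le N (@bp reals (fun x => P (oapp e x))).
Proof.
by move=> /D_with_constants dP; apply: (uniform_finiteness omin_creals dP).
Qed.

Lemma fdef_separates (W : finType) (P : (option W -> R) -> Prop) :
  @D reals _ P -> forall e : W -> R,
  @separates reals (@bp reals (fun x => P (oapp e x))) (fun x => P (oapp e x)).
Proof.
move=> /D_with_constants dP e.
have [X Xfin sepX] := creals_separates (creals_section e dP).
exact: bp_separates Xfin sepX.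
Qed.

End Formulas.

(** * Vertical decomposition *)

Section NthPoint.
Variable S : dstr.
Implicit Types (X : S -> Prop) (x y z : S).

(** Ranks count from 0 on the left; a rank names a point of a finite definable set without further
    parameters. *)
Fixpoint nth_pt n X x : Prop :=
  if n is m.+1 then
    X x /\ exists y, (y ≺ x /\ nth_pt m X y) /\ forall z, y ≺ z -> z ≺ x -> ~ X z
  else X x /\ forall y, y ≺ x -> ~ X y.

Lemma nth_pt_in n X x : nth_pt n X x -> X x.
Proof. by case: n => [|n] []. Qed.

Lemma nth_pt_uniq n X x y : nth_pt n X x -> nth_pt n X y -> x = y.
Proof.
elim: n x y => [|n IH] x y /=.
  move=> [Xx minx] [Xy miny]; case: (lt_total x y) => [lt|[//|lt]].
    by case: (miny x lt).
  by case: (minx y lt).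
move=> [Xx [x' [[x'x /IH Ex] nx]]] [Xy [y' [[y'y /Ex E] ny]]]; subst y'.
case: (lt_total x y) => [lt|[//|lt]].
  by case: (ny x x'x lt).
by case: (nx y y'y lt).
Qed.

Lemma nth_pt_ex N X x :
  X x -> card_le N (fun z => X z /\ z ≺ x) -> exists2 i, i <= N & nth_pt i X x.
Proof.
elim: N x => [|N IH] x Xx cardX.
  by exists 0 => //; split=> // y yx Xy; apply: (cardX y).
have [ex|nex] := pselect (exists y, X y /\ y ≺ x); last first.
  by exists 0 => //; split=> // y yx Xy; apply: nex; exists y.
have [|y [Xy yx] maxy] := finite_max _ ex; first by exists N.+1.
have [|i iN Xiy] := IH y Xy.
  apply: card_le_sub ((card_leS_rem N (conj Xy yx)).1 cardX) => z [Xz zy].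
  split; first by split=> //; order.
  by move=> zE; subst z; order.
exists i.+1 => //; split=> //; exists y; split=> // z yz zx Xz.
by have ? := maxy z (conj Xz zx); order.
Qed.

Lemma D_nth_pt (W : finType) (X : (W -> S) -> S -> Prop) n (w : W) :
  D (fun e : option W -> S => X (fun w => e (Some w)) (e None)) ->
  D (fun e => nth_pt n (X e) (e w)).
Proof.
elim: n W X w => [|n IH] W X w dX /=.
  have dXv (W' : finType) (r : W -> W') v :
      D (fun e : W' -> S => X (fun w => e (r w)) (e v)).
    exact: (D_rename (oapp r v) dX).
  by dfn; apply: (dXv _ id).
have dXv (W' : finType) (r : W -> W') v :
    D (fun e : W' -> S => X (fun w => e (r w)) (e v)).
  exact: (D_rename (oapp r v) dX).
apply: D_and; first exact: (dXv _ id).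
apply: D_ex; apply: D_and; last by dfn.
apply: D_and; first by dfn.
apply: (IH _ (fun e x => X (fun w => e (Some w)) x) None).
exact: (dXv _ (fun w => Some (Some w))).
Qed.

End NthPoint.

Lemma fin_bound (I : finType) (P : nat -> I -> Prop) :
    (forall m n i, m <= n -> P m i -> P n i) -> (forall i, exists N, P N i) ->
  exists N, forall i, P N i.
Proof.
move=> mono ex; suff [N HN] : exists N, forall i, i \in enum I -> P N i.
  by exists N => i; apply: HN; rewrite mem_enum.
elim: (enum I) => [|i l [N HN]]; first by exists 0.
have [N' HN'] := ex i; exists (maxn N N') => i'.
rewrite inE => /predU1P[->|/HN]; first by apply: mono HN'; rewrite leq_maxr.
by apply: mono; rewrite leq_maxl.
Qed.

Lemma fin_maximum (I : finType) (P : I -> Prop) (le : I -> I -> Prop) :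
    (forall i j, le i j \/ le j i) ->
    (forall i j k, le i j -> le j k -> le i k) -> (exists i, P i) ->
  exists2 i, P i & forall j, P j -> le j i.
Proof.
move=> tot trans [i0 Pi0].
suff [i Pi maxi] : exists2 i, P i & forall j, j \in enum I -> P j -> le j i.
  by exists i => // j; apply: maxi; rewrite mem_enum.
elim: (enum I) => [|k l [i Pi maxi]]; first by exists i0.
have [Pk|nPk] := pselect (P k); last first.
  by exists i => // j; rewrite inE => /predU1P[->//|/maxi].
case: (tot k i) => [ki|ik].
  by exists i => // j; rewrite inE => /predU1P[->//|/maxi].
exists k => // j; rewrite inE => /predU1P[-> _|jl Pj].
  by case: (tot k k).
exact: trans (maxi j jl Pj) ik.
Qed.

Lemma finite_fin (I : finType) (P : I -> Prop) : finite_pred P.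
Proof. by apply: finite_sub (finite_seq (enum I)) => i _; rewrite mem_enum. Qed.

(** * Curves, events and cells *)

Section Cells.
Variables (S : dstr) (V : finType) (phi : (V -> S) -> S -> S -> Prop).

Hypothesis dphi : forall (W : finType) (r : V -> W) a b,
  D (fun e : W -> S => phi (fun v => e (r v)) (e a) (e b)).
(** [omin] would demand that every constant be definable; [ufin] and [sep] are the consequences that
    hold for definability without parameters. *)
Hypothesis ufin : forall (W : finType) (P : (option W -> S) -> Prop), D P ->
  exists N, forall e : W -> S, card_le N (bp (fun x => P (oapp e x))).
Hypothesis sep : forall (W : finType) (P : (option W -> S) -> Prop), D P ->
  forall e : W -> S,
    separates (bp (fun x => P (oapp e x))) (fun x => P (oapp e x)).

Lemma ufin2 (P : (V -> S) -> (V -> S) -> S -> Prop) :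
    (forall (W : finType) (r r' : V -> W) a, D (fun e : W -> S =>
      P (fun v => e (r v)) (fun v => e (r' v)) (e a))) ->
  exists N, forall s s', card_le N (bp (P s s')).
Proof.
move=> dP; pose i1 (v : V) : V + V := inl v; pose i2 (v : V) : V + V := inr v.
have [N HN] := ufin (dP _ (fun v => Some (i1 v)) (fun v => Some (i2 v)) None).
by exists N => s s'; apply: (HN (glue s s')).
Qed.

Lemma sep2 (P : (V -> S) -> (V -> S) -> S -> Prop) :
    (forall (W : finType) (r r' : V -> W) a, D (fun e : W -> S =>
      P (fun v => e (r v)) (fun v => e (r' v)) (e a))) ->
  forall s s', separates (bp (P s s')) (P s s').
Proof.
move=> dP s s'; pose i1 (v : V) : V + V := inl v.
pose i2 (v : V) : V + V := inr v.
have := @sep _ _ (dP _ (fun v => Some (i1 v)) (fun v => Some (i2 v)) None) (glue s s').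
exact.
Qed.

Lemma phi_bound : exists N, forall s x, card_le N (bp (phi s x)).
Proof.
have [N HN] := ufin (dphi (fun v => Some (Some v)) (Some None) None).
by exists N => s x; apply: (HN (oapp s x)).
Qed.

Definition fiber_bound := sval (cid phi_bound).

Lemma card_fiber_bp s x : card_le fiber_bound (bp (phi s x)).
Proof. by rewrite /fiber_bound; case: cid. Qed.

(* Curves are cuts depending on x1: a cut is a lower set of the line, namely the
   empty set, the whole line, or the points below, or below and including, a
   breakpoint of phi s x1. *)
Definition curve_type : finType := (bool + (bool * 'I_fiber_bound.+1))%type.

Definition curve_cut (j : curve_type) (s : V -> S) (x y : S) : Prop :=
  match j with
  | inl b => b
  | inr (c, i) => exists b, nth_pt i (bp (phi s x)) b /\
                  if c then y ≼ b else y ≺ b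
  end.

Lemma curve_cut_lower j s x y z : y ≺ z -> curve_cut j s x z -> curve_cut j s x y.
Proof.
case: j => [[]|[c i]] //= yz [b [bi Hb]]; exists b; split=> //.
by case: c Hb => *; order.
Qed.

Lemma D_curve_cut j (W : finType) (r : V -> W) a b :
  D (fun e : W -> S => curve_cut j (fun v => e (r v)) (e a) (e b)).
Proof.
case: j => [c|[c i]] /=; first exact: D_cst.
apply: D_ex; apply: D_and; last by case: c; dfn.
apply: (D_nth_pt (X := fun e x => bp (phi (fun v => e (Some (r v))) (e (Some a))) x)).
by rewrite /bp /near; dfn.
Qed.

(** A breakpoint b from y to z, with y ≺ z, distinguishes them by one of its two cuts: the one
    containing b if b ≺ z, the other one if b = z. *)
Lemma curve_cut_phi s x y z : (forall j, curve_cut j s x y <-> curve_cut j s x z) ->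
  (phi s x y <-> phi s x z).
Proof.
have phisep := @sep _ _ (dphi (fun v => Some (Some v)) (Some None) None) (oapp s x).
have half y' z' : y' ≺ z' -> (forall j, curve_cut j s x y' <-> curve_cut j s x z') ->
    (phi s x y' <-> phi s x z').
  move=> yz E; apply: phisep => // b yb bz bb.
  have [|i iN bi] := nth_pt_ex (N := fiber_bound) bb.
    by apply: card_le_sub (card_fiber_bp s x) => ? [].
  have {}iN : i < fiber_bound.+1 by [].
  have E1 := E (inr (true, Ordinal iN)); have E2 := E (inr (false, Ordinal iN)).
  have [lt|ge] := lt_leP b z'.
    have /E1 [b' [/(nth_pt_uniq bi) <-]] : curve_cut (inr (true, Ordinal iN)) s x y'.
      by exists b; split.
    by [].
  have bE : b = z' by order.
  have /E2 [b' [/(nth_pt_uniq bi) <-]] : curve_cut (inr (false, Ordinal iN)) s x y'.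
    by exists b; split=> //=; order.
  by rewrite bE => /lt_irr.
move=> E; case: (lt_total y z) => [lt|[->//|lt]]; first exact: half.
by apply: iff_sym; apply: half => // j; apply: iff_sym.
Qed.

Definition pred_sub (A B : S -> Prop) := forall y, A y -> B y.

Lemma curve_cut_total j s x (A : S -> Prop) : (forall y z, y ≺ z -> A z -> A y) ->
  pred_sub A (curve_cut j s x) \/ pred_sub (curve_cut j s x) A.
Proof.
move=> lowA; have [?|/existsNP[y /not_implyP[Ay nHy]]] := pselect (pred_sub A (curve_cut j s x)).
  by left.
right=> z Hz; case: (lt_total z y) => [lt|[->//|lt]]; first exact: lowA lt Ay.
by case: nHy; apply: curve_cut_lower lt Hz.
Qed.

(** Over all tau, the patterns record the shape of the fiber of phi over x, irrespective of the
    heights of the curves. *)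
Definition pattern (tau : {ffun curve_type -> bool}) (s : V -> S) (x : S) :=
  exists y, (forall j, curve_cut j s x y <-> tau j) /\ phi s x y.

Definition event_type : finType := (bool * curve_type + {ffun curve_type -> bool})%type.

(** The cut h is left general: it will be a curve, or a side recovered from a set Delta. *)
Definition rho (q : event_type) (h : S -> S -> Prop) (s : V -> S) (x : S) : Prop :=
  match q with
  | inl (b, j) => if b then pred_sub (h x) (curve_cut j s x) else pred_sub (curve_cut j s x) (h x)
  | inr tau => pattern tau s x
  end.

Lemma rho_ext q h h' s x : h x = h' x -> rho q h s x = rho q h' s x.
Proof. by case: q => [[[] j]|tau] //= ->. Qed.

Lemma D_rho q (W : finType) (h : (W -> S) -> S -> S -> Prop) (r : V -> W) a :
    (forall (W' : finType) (r' : W -> W') a b,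
      D (fun e : W' -> S => h (fun w => e (r' w)) (e a) (e b))) ->
  D (fun e : W -> S => rho q (h e) (fun v => e (r v)) (e a)).
Proof.
move=> dh; have dH := D_curve_cut.
by case: q => [[[] j]|tau] /=; rewrite /pattern /pred_sub; dfn.
Qed.

Definition event j s q s' := bp (rho q (curve_cut j s) s').

Lemma D_rho_curve_cut j q (W : finType) (r r' : V -> W) a : D (fun e : W -> S =>
  rho q (curve_cut j (fun v => e (r v))) (fun v => e (r' v)) (e a)).
Proof.
apply: (D_rho q (h := fun e => curve_cut j (fun v => e (r v)))) => W' r0 a' b'.
exact: (D_curve_cut j (fun v => r0 (r v))).
Qed.

Lemma event_bound :
  exists N, forall (jq : curve_type * event_type) s s', card_le N (event jq.1 s jq.2 s').
Proof.
apply: (fin_bound (P := fun N (jq : curve_type * event_type) => forall s s',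
  card_le N (event jq.1 s jq.2 s'))).
  by move=> m n i mn E s s'; apply: (card_le_weak (pt S) mn (E s s')).
move=> [j q]; apply: (ufin2 (P := fun s s' => rho q (curve_cut j s) s')).
by move=> W r r' a; apply: D_rho_curve_cut.
Qed.

Definition max_events := sval (cid event_bound).

Lemma card_event j q s s' : card_le max_events (event j s q s').
Proof. by rewrite /max_events; case: cid => N HN; apply: (HN (j, q)). Qed.

Lemma sep_event j s q s' : separates (event j s q s') (rho q (curve_cut j s) s').
Proof. by apply: (sep2 (P := fun s s' => rho q (curve_cut j s) s')); apply: D_rho_curve_cut. Qed.

(* Cuts of the x1-axis: [inl false] and [inl true] are the trivial ones, and
   [inr (b, q, i, c)] is the cut below or above the i-th event of type [q] of
   the curve on side [b] of the cell. *)
Definition base_cut_type : finType := (bool + bool * event_type * 'I_max_events.+1 * bool)%type.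

Definition base_cut (g : base_cut_type) (j : bool -> curve_type) (s : bool -> V -> S) (s2 : V -> S)
    (x : S) : Prop :=
  match g with
  | inl b => b
  | inr (b, q, i, c) => exists z, nth_pt i (event (j b) (s b) q s2) z /\
                        if c then x ≼ z else x ≺ z
  end.

(** Differences of lower sets treat open, closed and infinite ends alike. The parameters s belong to
    the curves, s2 to the events at the two ends. *)
Definition cell (j : bool -> curve_type) (g : bool -> base_cut_type) (s s2 : bool -> V -> S)
    (x y : S) : Prop :=
  (~ base_cut (g false) j s (s2 false) x /\ base_cut (g true) j s (s2 true) x) /\
  (~ curve_cut (j false) (s false) x y /\ curve_cut (j true) (s true) x y).

Lemma D_cell j g (W : finType) (r r2 : bool -> V -> W) a b :
  D (fun e : W -> S =>
    cell j g (fun b v => e (r b v)) (fun b v => e (r2 b v)) (e a) (e b)).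
Proof.
have dG c (W' : finType) (r' r2' : bool -> V -> W') a' : D (fun e : W' -> S =>
    base_cut c j (fun b v => e (r' b v)) (fun v => e (r2' false v)) (e a')).
  case: c => [c|[[[b' q] i] c]] /=; first exact: D_cst.
  apply: D_ex; apply: D_and; last by case: c; dfn.
  apply: (D_nth_pt (X := fun e x => event (j b') (fun v => e (Some (r' b' v))) q
    (fun v => e (Some (r2' false v))) x)).
  have dR := D_rho_curve_cut; rewrite /event /bp /near; dfn.
rewrite /cell; apply: D_and; apply: D_and.
- by apply: D_not; apply: dG.
- exact: (dG _ _ r (fun _ => r2 true)).
- by apply: D_not; apply: D_curve_cut.
- exact: D_curve_cut.
Qed.

Definition dom (Delta : S -> S -> Prop) x := exists y, Delta x y.

Definition side (Delta : S -> S -> Prop) (b : bool) (x y : S) : Prop :=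
  if b then exists z, Delta x z /\ y ≼ z else forall z, Delta x z -> y ≺ z.

(** The negation will define I. Only the points of Delta enter, its bounding cuts being recovered by
    [side], so that the parameters defining Delta do not matter. *)
Definition compatible (Delta : S -> S -> Prop) (s : V -> S) : Prop :=
  ((exists x, dom Delta x) /\
   (forall x y z, dom Delta x -> dom Delta z -> x ≺ y -> y ≺ z -> dom Delta y)) /\
  (((forall x, dom Delta x -> near x (dom Delta)) \/
    (forall x y, dom Delta x -> dom Delta y -> x = y)) /\
   ((forall b q x y, dom Delta x -> dom Delta y ->
      (rho q (side Delta b) s x <-> rho q (side Delta b) s y)) /\
    (forall j x, dom Delta x -> (forall y, Delta x y -> curve_cut j s x y) \/
                                (forall y, Delta x y -> ~ curve_cut j s x y)))).

Lemma D_compatible (W : finType) (Delta : (W -> S) -> S -> S -> Prop) (r : V -> W) :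
    (forall (W' : finType) (r' : W -> W') a b,
      D (fun e : W' -> S => Delta (fun w => e (r' w)) (e a) (e b))) ->
  D (fun e : W -> S => compatible (Delta e) (fun v => e (r v))).
Proof.
move=> dD; have dH := D_curve_cut.
have ds b (W' : finType) (r' : W -> W') a c :
    D (fun e : W' -> S => side (Delta (fun w => e (r' w))) b (e a) (e c)).
  by case: b => /=; dfn.
have dR q b (W' : finType) (r' : W -> W') (r1 : V -> W') a : D (fun e : W' -> S =>
    rho q (side (Delta (fun w => e (r' w))) b) (fun v => e (r1 v)) (e a)).
  apply: (D_rho q (h := fun e => side (Delta (fun w => e (r' w))) b)).
  by move=> W1 r2 a1 b1; apply: (ds _ _ (fun w => r2 (r' w))).
have ddom (W' : finType) (r' : W -> W') a :
    D (fun e : W' -> S => dom (Delta (fun w => e (r' w))) (e a)).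
  by rewrite /dom; apply: D_ex; apply: (dD _ (fun w => Some (r' w))).
by rewrite /compatible /near; dfn.
Qed.

Lemma rho_pred_sub b j h s x :
  rho (inl (b, j)) h s x <->
  if b then pred_sub (h x) (curve_cut j s x) else pred_sub (curve_cut j s x) (h x).
Proof. by []. Qed.

Lemma base_cut_lower g j s s2 x y : y ≺ x -> base_cut g j s s2 x -> base_cut g j s s2 y.
Proof.
case: g => [[]|[[[b q] i] c]] //= yx [z [zi Hz]]; exists z; split=> //.
by case: c Hz => *; order.
Qed.

Lemma side_cell j g s s2 b x : dom (cell j g s s2) x ->
  side (cell j g s s2) b x = curve_cut (j b) (s b) x.
Proof.
move=> [y0 [[nG0 G1] [nH0 H1]]]; apply/funext => y; apply/propext.
case: b => /=; split.
- move=> [z [[_ [_ Hz]] yz]]; case: (lt_total y z) => [lt|[->//|//]].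
  exact: curve_cut_lower lt Hz.
- move=> Hy; have [Hy0|nHy0] := pselect (curve_cut (j false) (s false) x y).
    exists y0; split=> // lt; apply: nH0; exact: curve_cut_lower lt Hy0.
  by exists y; split=> //; apply: lt_irr.
- move=> lty; apply: contrapT => nHy.
  have [Hy|nHy'] := pselect (curve_cut (j true) (s true) x y).
    by apply: (@lt_irr _ y); apply: lty.
  have yy0 : y ≺ y0 by apply: lty.
  by apply: nHy'; apply: curve_cut_lower yy0 H1.
- move=> Hy z [_ [nHz _]]; case: (lt_total y z) => [//|[yz|zy]].
    by case: nHz; rewrite -yz.
  by case: nHz; apply: curve_cut_lower zy Hy.
Qed.

Section Family.
Variables (T : finType) (sigma : T -> V -> S).

Definition apart (E : S -> Prop) x y :=
  forall z, E z -> ~ (x ≼ z /\ z ≼ y) /\ ~ (y ≼ z /\ z ≼ x).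

Definition curve_event (j : curve_type) (t : T) x :=
  exists q t', event j (sigma t) q (sigma t') x.

Definition cell_event (j : bool -> curve_type) (t : bool -> T) x :=
  exists b, curve_event (j b) (t b) x.

Notation family_cell j g t t2 :=
  (cell j g (fun b => sigma (t b)) (fun b => sigma (t2 b))).

Lemma cell_event_finite j t : finite_pred (cell_event j t).
Proof.
apply: finite_sub (finite_bigcup (finite_fin (fun _ : bool * event_type * T => True))
  (Y := fun i => event (j i.1.1) (sigma (t i.1.1)) i.1.2 (sigma i.2)) _) => [|i _].
  by move=> x [b [q [t' Ex]]]; exists (b, q, t').
by exists max_events; apply: card_event.
Qed.

Lemma cell_event_nth j t x : cell_event j t x -> exists b q t' (i : 'I_max_events.+1),
  nth_pt i (event (j b) (sigma (t b)) q (sigma t')) x.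
Proof.
move=> [b [q [t' Ex]]]; have [|i iN xi] := nth_pt_ex (N := max_events) Ex.
  by apply: card_le_sub (card_event (j b) q (sigma (t b)) (sigma t')) => y [].
have {}iN : i < max_events.+1 by [].
by exists b, q, t', (Ordinal iN).
Qed.

Lemma base_cut_nth j t b q t' (i : 'I_max_events.+1) c z x :
    nth_pt i (event (j b) (sigma (t b)) q (sigma t')) z ->
  base_cut (inr (b, q, i, c)) j (fun b => sigma (t b)) (sigma t') x <->
  if c then x ≼ z else x ≺ z.
Proof.
move=> zi; split=> [[z' [/(nth_pt_uniq zi) <-]] //|xz].
by exists z; split.
Qed.

Lemma rho_const j t x y : apart (cell_event j t) x y -> forall b q t',
  rho q (curve_cut (j b) (sigma (t b))) (sigma t') x <->
  rho q (curve_cut (j b) (sigma (t b))) (sigma t') y.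
Proof.
move=> ap b q t'; have sepE := @sep_event (j b) (sigma (t b)) q (sigma t').
have ev z : event (j b) (sigma (t b)) q (sigma t') z -> cell_event j t z.
  by exists b, q, t'.
case: (lt_total x y) => [lt|[->//|lt]]; last apply: iff_sym.
  by apply: sepE lt _ => z xz zy /ev/ap[nz _]; apply: nz.
by apply: sepE lt _ => z yz zx /ev/ap[_ nz]; apply: nz.
Qed.

Lemma base_interval (t0 : T) j t x : exists (g : bool -> base_cut_type) (t2 : bool -> T),
  let K y := ~ base_cut (g false) j (fun b => sigma (t b)) (sigma (t2 false)) y /\
             base_cut (g true) j (fun b => sigma (t b)) (sigma (t2 true)) y in
  [/\ K x, (forall y, K y -> near y K) \/ (forall y z, K y -> K z -> y = z) &
   forall y, K y -> y = x \/ apart (cell_event j t) x y].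
Proof.
have [Ex|nEx] := pselect (cell_event j t x).
  have [b [q [t' [i xi]]]] := cell_event_nth Ex.
  (* The lower cut leaves x out and the upper one contains it, so that x alone remains. *)
  exists (fun c => inr (b, q, i, c)), (fun _ => t') => K.
  have KE y : K y <-> y = x.
    rewrite /K (base_cut_nth false y xi) (base_cut_nth true y xi); split=> [[? ?]|->].
      by order.
    by split; apply: lt_irr.
  split; first by apply/KE.
    by right=> y z /KE -> /KE ->.
  by move=> y /KE ->; left.
have Efin := cell_event_finite j t.
have [g0 [t0' [nG0 open0 ev0]]] : exists g0 t0',
    let G0 := base_cut g0 j (fun b => sigma (t b)) (sigma t0') in
    [/\ ~ G0 x, forall y, ~ G0 y -> near y (fun z => ~ G0 z) &
     forall y z, ~ G0 y -> cell_event j t z -> z ≼ x -> z ≺ y].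
  have [ex|nex] := pselect (exists z, cell_event j t z /\ z ≺ x); last first.
    exists (inl false), t0; split=> //; first by move=> y _; apply: nearT.
    move=> y z _ Ez zx; case: (lt_total z x) => [zx'|[zE|/zx//]].
      by case: nex; exists z.
    by case: nEx; rewrite -zE.
  have [|z [Ez zx] maxz] := finite_max _ ex; first by apply: finite_sub Efin => ? [].
  have [b [q [t' [i zi]]]] := cell_event_nth Ez.
  (* [true] here and [false] at the right end exclude both end events from the base. *)
  exists (inr (b, q, i, true)), t' => G0.
  have GE y : G0 y <-> y ≼ z by exact: (base_cut_nth true y zi).
  split; first by rewrite GE; order.
    move=> y; rewrite GE => /contrapT zy; have [v yv] := unbounded_r y.
    exists z, v; split=> //; split=> // w zw wv; rewrite GE; order.
  move=> y w; rewrite GE => /contrapT zy Ew wx.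
  have wx' : w ≺ x.
    by case: (lt_total w x) => [//|[wE|/wx//]]; case: nEx; rewrite -wE.
  by have ? := maxz w (conj Ew wx'); order.
have [g1 [t1' [G1x open1 ev1]]] : exists g1 t1',
    let G1 := base_cut g1 j (fun b => sigma (t b)) (sigma t1') in
    [/\ G1 x, forall y, G1 y -> near y G1 &
     forall y z, G1 y -> cell_event j t z -> x ≼ z -> y ≺ z].
  have [ex|nex] := pselect (exists z, cell_event j t z /\ x ≺ z); last first.
    exists (inl true), t0; split=> //; first by move=> y _; apply: nearT.
    move=> y z _ Ez zx; case: (lt_total z x) => [/zx//|[zE|zx']].
      by case: nEx; rewrite -zE.
    by case: nex; exists z.
  have [|z [Ez zx] minz] := finite_min _ ex; first by apply: finite_sub Efin => ? [].
  have [b [q [t' [i zi]]]] := cell_event_nth Ez.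
  exists (inr (b, q, i, false)), t' => G1.
  have GE y : G1 y <-> y ≺ z by exact: (base_cut_nth false y zi).
  split; first by rewrite GE; order.
    move=> y; rewrite GE => zy; have [u uy] := unbounded_l y.
    by exists u, z; split=> //; split=> // w uw wz; rewrite GE.
  move=> y w; rewrite GE => zy Ew wx.
  have wx' : x ≺ w.
    by case: (lt_total w x) => [/wx//|[wE|//]]; case: nEx; rewrite -wE.
  by have ? := minz w (conj Ew wx'); order.
exists (fun b => if b then g1 else g0), (fun b => if b then t1' else t0') => K.
split=> //.
  by left=> y [/open0 n0 /open1 n1]; apply: near_and.
move=> y [nG0y G1y]; right=> z Ez; split=> -[le1 le2].
  by have ? := ev1 y z G1y Ez le1; order.
by have ? := ev0 y z nG0y Ez le2; order.
Qed.

Lemma cells_cover (t0 : T) x y : exists j g t t2,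
  family_cell j g t t2 x y /\
  forall t', compatible (family_cell j g t t2) (sigma t').
Proof.
have lowH j s z : forall u v, u ≺ v -> curve_cut j s z v -> curve_cut j s z u.
  by move=> u v; apply: curve_cut_lower.
(* The sides are the greatest cut without y and the least cut with y, among all curves of the
   family. *)
have [[jb tb] /= nHb maxb] : exists2 i : curve_type * T, ~ curve_cut i.1 (sigma i.2) x y &
    forall k : curve_type * T, ~ curve_cut k.1 (sigma k.2) x y ->
      pred_sub (curve_cut k.1 (sigma k.2) x) (curve_cut i.1 (sigma i.2) x).
  apply: (fin_maximum (P := fun i : curve_type * T => ~ curve_cut i.1 (sigma i.2) x y)
    (le := fun k i => pred_sub (curve_cut k.1 (sigma k.2) x) (curve_cut i.1 (sigma i.2) x))).
  - by move=> i k; apply: curve_cut_total; apply: lowH.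
  - by move=> i k l ik kl z /ik /kl.
  - by exists (inl false, t0).
have [[jt tt] /= Ht mint] : exists2 i : curve_type * T, curve_cut i.1 (sigma i.2) x y &
    forall k : curve_type * T, curve_cut k.1 (sigma k.2) x y ->
      pred_sub (curve_cut i.1 (sigma i.2) x) (curve_cut k.1 (sigma k.2) x).
  apply: (fin_maximum (P := fun i : curve_type * T => curve_cut i.1 (sigma i.2) x y)
    (le := fun k i => pred_sub (curve_cut i.1 (sigma i.2) x) (curve_cut k.1 (sigma k.2) x))).
  - by move=> i k; apply: curve_cut_total; apply: lowH.
  - by move=> i k l ik kl z /kl /ik.
  - by exists (inl true, t0).
pose j b := if b then jt else jb; pose t b := if b then tt else tb.
have [g [t2 [Kx Kopen Kap]]] := base_interval t0 j t x.
pose K z := ~ base_cut (g false) j (fun b => sigma (t b)) (sigma (t2 false)) z /\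
            base_cut (g true) j (fun b => sigma (t b)) (sigma (t2 true)) z.
have {}Kx : K x := Kx.
have {}Kopen : (forall z, K z -> near z K) \/ (forall z w, K z -> K w -> z = w) :=
  Kopen.
have {}Kap : forall z, K z -> z = x \/ apart (cell_event j t) x z := Kap.
exists j, g, t, t2.
have Krho z b q t' : K z -> rho q (curve_cut (j b) (sigma (t b))) (sigma t') z <->
    rho q (curve_cut (j b) (sigma (t b))) (sigma t') x.
  by move=> /Kap[->//|/rho_const Hr]; apply: iff_sym; apply: Hr.
split; first by split.
have domE z : dom (family_cell j g t t2) z <-> K z.
  split=> [[w []]//|Kz].
  (* The fiber is non-empty because the upper cut is not contained in the lower one; this is a
     relation between the two curves, so it persists from x to z. *)
  have : ~ pred_sub (curve_cut jt (sigma tt) z) (curve_cut jb (sigma tb) z).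
    have := Krho z true (inl (true, jb)) tb Kz; rewrite !rho_pred_sub => E.
    by move/E => /(_ y Ht).
  by move=> /existsNP[w /not_implyP[Hw nHw]]; exists w; split.
move=> t'.
have rhoE b q z : dom (family_cell j g t t2) z ->
    rho q (side (family_cell j g t t2) b) (sigma t') z <->
    rho q (curve_cut (j b) (sigma (t b))) (sigma t') x.
  move=> dz; rewrite (rho_ext q _ (side_cell b dz)); apply: Krho; exact/domE.
split; first split.
- by exists x; apply/domE.
- move=> u v w /domE[nGu _] /domE[_ Gw] uv vw; apply/domE; split.
    by move=> Gv; apply: nGu; apply: base_cut_lower uv Gv.
  exact: base_cut_lower vw Gw.
split.
  case: Kopen => [open|single]; [left|right].
    by move=> z /domE/open; apply: near_sub => w /domE.
  by move=> u v /domE Ku /domE Kv; apply: single.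
split=> [b q u v du dv|k z dz]; first by rewrite !rhoE.
have Kz := (domE z).1 dz.
have [Hk|nHk] := pselect (curve_cut k (sigma t') x y).
  left=> w [_ [_ Hw]]; have := Krho z true (inl (true, k)) t' Kz.
  by rewrite !rho_pred_sub => -[_ Hr]; apply: (Hr (mint (k, t') Hk)).
right=> w [_ [nHw _]] Hkw; apply: nHw.
have := Krho z false (inl (false, k)) t' Kz.
by rewrite !rho_pred_sub => -[_ Hr]; apply: (Hr (maxb (k, t') nHk)).
Qed.

End Family.

(** The positions of points of Delta relative to the curves of s are read off the upper side, hence
    form one vector tau on all of Delta. The pattern tau persists from x to x', which gives a point
    w there satisfying phi, and y' has the same position as w. *)
Lemma compatible_uncrossed Delta s x y x' y' : compatible Delta s ->
  Delta x y -> Delta x' y' -> phi s x y -> phi s x' y'.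
Proof.
move=> [_ [_ [rhoc uncut]]] Dxy Dxy' phixy.
have dx : dom Delta x by exists y.
have dx' : dom Delta x' by exists y'.
have HE z w j : Delta z w -> curve_cut j s z w <-> pred_sub (side Delta true z) (curve_cut j s z).
  move=> Dzw; split=> [Hw|Hs]; last by apply: Hs; exists w; split=> //; apply: lt_irr.
  move=> u [v [Dv uv]]; have [|Hall|Hno] := uncut j z; first by exists w.
    by case: (lt_total u v) => [lt|[->|//]]; [apply: curve_cut_lower lt _|]; apply: Hall.
  by case: (Hno w).
pose tau := [ffun j => `[< curve_cut j s x y >]].
have tauE j : curve_cut j s x y <-> tau j.
  by rewrite ffunE; split=> [?|/asboolP//]; apply/asboolP.
have : pattern tau s x by exists y.
move=> /(rhoc true (inr tau) x x' dx dx')[w [tauw phiw]].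
apply/(curve_cut_phi (z := w) _) => // j.
rewrite tauw -tauE (HE x y) // (HE x' y') //.
by have := rhoc true (inl (true, j)) x' x dx' dx; rewrite !rho_pred_sub.
Qed.

(** * Coding cells by a side and an event *)

Section Counting.
Variables (T : finType) (sigma : T -> V -> S).

Notation family_cell j g t t2 :=
  (cell j g (fun b => sigma (t b)) (fun b => sigma (t2 b))).

Lemma apart_sym E x y : apart E x y -> apart E y x.
Proof. by move=> ap z /ap[]. Qed.

Lemma base_cut_apart g j t t' x y : apart (cell_event sigma j t) x y ->
  base_cut g j (fun b => sigma (t b)) (sigma t') x ->
  base_cut g j (fun b => sigma (t b)) (sigma t') y.
Proof.
case: g => [//|[[[b q] i] c]] ap /= [z [zi xz]]; exists z; split=> //.
have [|n1 n2] := ap z; first by exists b, q, t'; apply: nth_pt_in zi.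
case: c xz => xz.
  by move=> zy; apply: n1; order.
by apply: contrapT => yz; apply: n1; order.
Qed.

(** The end events are not mentioned, so that cells given by different events can be compared. *)
Definition maximal_cell j t (Delta : S -> S -> Prop) :=
  [/\ forall b x, dom Delta x -> side Delta b x = curve_cut (j b) (sigma (t b)) x,
      forall t', compatible Delta (sigma t'),
      forall x y, dom Delta x -> apart (cell_event sigma j t) x y -> dom Delta y &
      forall x y, Delta x y <->
        dom Delta x /\ ~ side Delta false x y /\ side Delta true x y].

Lemma cell_maximal j g t t2 :
    (forall t', compatible (family_cell j g t t2) (sigma t')) ->
  maximal_cell j t (family_cell j g t t2).
Proof.
move=> comp; split=> //.
- by move=> b x dx; apply: side_cell.
- move=> x y [z [[nG0 G1] [nHz Hz]]] ap.
  have [w [Hw nHw]] : exists w,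
      curve_cut (j true) (sigma (t true)) y w /\ ~ curve_cut (j false) (sigma (t false)) y w.
    apply: contrapT => nw; apply: nHz.
    have := rho_const ap true (inl (true, j false)) (t false).
    rewrite !rho_pred_sub => -[_]; apply=> // w Hw.
    by apply: contrapT => nHw; apply: nw; exists w.
  exists w; split=> //; split; last exact: base_cut_apart ap G1.
  by move/(base_cut_apart (apart_sym ap)).
- move=> x y; split=> [Dxy|[dx [nL U]]].
    have dx : dom (family_cell j g t t2) x by exists y.
    by rewrite !(side_cell _ dx); case: Dxy => _ [].
  by move: nL U; rewrite !(side_cell _ dx); case: dx => z [].
Qed.

Definition open_dom Delta := forall x, dom Delta x -> near x (dom Delta).

(** Compatibility makes the relations of the sides constant on the domain, which excludes
    breakpoints at its inner points. *)
Lemma open_no_event j t Delta x : maximal_cell j t Delta -> open_dom Delta ->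
  dom Delta x -> ~ cell_event sigma j t x.
Proof.
move=> [sideE comp _ _] opn dx [b [q [t' bpx]]]; apply: bpx.
apply: near_sub (opn x dx) => y dy.
have [_ [_ [rhoc _]]] := comp t'; have := rhoc b q y x dy dx.
by rewrite (rho_ext q _ (sideE b y dy)) (rho_ext q _ (sideE b x dx)).
Qed.

(* A cell is identified by one of its two sides, together with the event of
   that side at its left end, if any; the boolean [true] marks the cells whose
   domain is an open interval, the other ones being vertical. *)
Definition code : finType :=
  ((bool * (curve_type * T)) * option (event_type * 'I_max_events.+1 * T * bool))%type.

Definition coded (c : code) (Delta : S -> S -> Prop) :=
  exists j t, maximal_cell j t Delta /\ c.1.2 = (j c.1.1, t c.1.1) /\
  match c.2 with
  | None => open_dom Delta /\ forall x y, dom Delta x -> y ≼ x -> dom Delta y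
  | Some (q, i, t', o) => exists z,
      nth_pt i (event c.1.2.1 (sigma c.1.2.2) q (sigma t')) z /\
      if o then open_dom Delta /\ (forall x, dom Delta x -> z ≺ x) /\
                forall x y, dom Delta x -> z ≺ y -> y ≼ x -> dom Delta y
      else forall x, dom Delta x <-> x = z
  end.

Lemma coded_ex j g t t2 :
    (forall t', compatible (family_cell j g t t2) (sigma t')) ->
  exists c, coded c (family_cell j g t t2).
Proof.
move=> comp; have maxD := cell_maximal comp.
move: (family_cell j g t t2) comp maxD => Delta comp maxD.
have [_ _ ext _] := maxD.
have [[[x dx] convex] [opn _]] := comp (t true).
have Efin := cell_event_finite sigma j t.
case: opn => [opn|single]; last first.
  (* Otherwise maximality would extend the domain to points near x. *)
  have Ex : cell_event sigma j t x.
    apply: contrapT => nEx.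
    have [v xv free] := finite_free_r x Efin; have [y [xy yv]] := dense xv.
    suff dy : dom Delta y by have xyE := single _ _ dx dy; subst y; order.
    apply: (ext x) => // z Ez; split=> -[le1 le2]; last by order.
    case: (lt_total x z) => [xz|[xz|zx]]; first by case: (free z xz _ Ez); order.
      by case: nEx; rewrite xz.
    by order.
  have [b [q [t' [i xi]]]] := cell_event_nth Ex.
  exists ((b, (j b, t b)), Some (q, i, t', false)), j, t; split=> //; split=> //.
  by exists x; split=> // y; split=> [dy|->//]; apply: single.
have nE y := open_no_event maxD opn (x := y).
have [ex|nex] := pselect (exists z, cell_event sigma j t z /\ z ≺ x); last first.
  exists ((false, (j false, t false)), None), j, t; do 3 (split=> //).
  move=> y z dy zy; case: (lt_total x z) => [xz|[<-//|zx]].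
    case: (lt_total z y) => [lt|[->//|/zy//]]; exact: convex dx dy xz lt.
  apply: (ext x) => // w Ew; split=> -[le1 le2]; first by order.
  case: (lt_total w x) => [wx|[wx|/le2//]]; first by case: nex; exists w.
  by apply: (nE x dx); rewrite -wx.
have [|z [Ez zx] maxz] := finite_max _ ex; first by apply: finite_sub Efin => ? [].
have [b [q [t' [i zi]]]] := cell_event_nth Ez.
exists ((b, (j b, t b)), Some (q, i, t', true)), j, t; do 2 (split=> //).
exists z; split=> //; split=> //; split.
  move=> y dy; case: (lt_total z y) => [//|[zy|yz]].
    by case: (nE y dy); rewrite -zy.
  by case: (nE z _ Ez); apply: convex dy dx yz zx.
move=> y w dy zw wy; case: (lt_total x w) => [xw|[<-//|wx]].
  case: (lt_total w y) => [lt|[->//|/wy//]]; exact: convex dx dy xw lt.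
apply: (ext x) => // u Eu; split=> -[le1 le2]; first by order.
case: (lt_total u x) => [ux|[ux|/le2//]].
  by have ? := maxz u (conj Eu ux); order.
by apply: (nE x dx); rewrite -ux.
Qed.

(** The other side of Delta' does not pass through the fiber of Delta, so this fiber lies on one
    side of it; the shared side and a point of Delta' over x decide on which. *)
Lemma side_sub d j t j' t' Delta Delta' x :
    maximal_cell j t Delta -> maximal_cell j' t' Delta' ->
    j d = j' d -> t d = t' d -> dom Delta x -> dom Delta' x ->
  if d then pred_sub (side Delta' false x) (side Delta false x)
  else pred_sub (side Delta true x) (side Delta' true x).
Proof.
move=> [sideE comp _ DE] [sideE' comp' _ DE'] jd td dx dx'.
have low b := @curve_cut_lower (j' b) (sigma (t' b)) x.
have same : side Delta d x = side Delta' d x by rewrite sideE // sideE' // jd td.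
have [_ [_ [_ uncut]]] := comp (t' (~~ d)).
have {uncut} := uncut (j' (~~ d)) x dx.
case: (dx') => z' Dz'; have [_ [nLz' Uz']] := (DE' x z').1 Dz'.
case: d jd td same => jd td same [] uncut.
- move: Uz'; rewrite -same => -[z [Dz zz']].
  case: nLz'; rewrite (sideE' false x dx'); have Hz := uncut z Dz.
  case: (lt_total z' z) => [lt|[->//|//]]; exact: low lt Hz.
- move=> y Ly'; apply: contrapT => nLy.
  apply: (uncut y); last by rewrite -(sideE' false x dx').
  apply/DE; split=> //; split=> //; rewrite same (sideE' true x dx').
  by move: Uz'; rewrite (sideE' true x dx'); apply: low; apply: Ly'.
- move=> y [z [Dz yz]]; rewrite (sideE' true x dx'); have Hz := uncut z Dz.
  case: (lt_total y z) => [lt|[->//|/yz//]]; exact: low lt Hz.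
- have {}Uz' : curve_cut (j' true) (sigma (t' true)) x z' by rewrite -(sideE' true x dx').
  have nUz : ~ side Delta true x z'.
    by move=> Uz; apply: (uncut z') => //; apply/DE; rewrite same.
  case: dx => z Dz; have zz' : z ≺ z'.
    by apply: contrapT => z'z; apply: nUz; exists z.
  by case: (uncut z Dz); apply: low zz' Uz'.
Qed.

Lemma side_eq d j t j' t' Delta Delta' x :
    maximal_cell j t Delta -> maximal_cell j' t' Delta' ->
    j d = j' d -> t d = t' d -> dom Delta x -> dom Delta' x ->
  forall b, side Delta b x = side Delta' b x.
Proof.
move=> maxD maxD' jd td dx dx'.
have same : side Delta d x = side Delta' d x.
  by case: maxD maxD' => sideE _ _ _ [sideE' _ _ _]; rewrite sideE // sideE' // jd td.
have S1 := side_sub maxD maxD' jd td dx dx'.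
have S2 := side_sub maxD' maxD (esym jd) (esym td) dx' dx.
have other : side Delta (~~ d) x = side Delta' (~~ d) x.
  by apply/funext => y; apply/propext; case: d S1 S2 {jd td same} => S1 S2; split;
    [apply: S2|apply: S1|apply: S1|apply: S2].
by case: d same other {jd td S1 S2} => same other [].
Qed.

(** If Delta' ended before y, its curves would have an event z between x and y. But they agree with
    the curves of Delta at x, hence on all of dom Delta, as both inclusions persist there; so z
    would be an event inside an open domain. *)
Lemma dom_right d j t j' t' Delta Delta' x y :
    maximal_cell j t Delta -> maximal_cell j' t' Delta' ->
    j d = j' d -> t d = t' d -> open_dom Delta ->
    dom Delta x -> dom Delta' x -> dom Delta y -> x ≺ y -> dom Delta' y.
Proof.
move=> maxD maxD' jd td opn dx dx' dy xy; apply: contrapT => ndy.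
have [_ _ ext' _] := maxD'; have [sideE comp _ _] := maxD.
have [sideE' _ _ _] := maxD'.
have [z [Ez [xz zy]]] : exists z, cell_event sigma j' t' z /\ x ≼ z /\ z ≼ y.
  apply: contrapT => nz; apply: ndy; apply: (ext' x) => // z Ez.
  by split=> -[le1 le2]; [apply: nz; exists z|order].
have dz : dom Delta z.
  have [[_ convex] _] := comp (t true).
  case: (lt_total x z) => [lt|[<-//|/xz//]].
  case: (lt_total z y) => [lt'|[->//|/zy//]]; exact: convex dx dy lt lt'.
have nE := open_no_event maxD opn dz.
case: Ez => b [q [s bpz]].
have HE w : dom Delta w -> curve_cut (j' b) (sigma (t' b)) w = curve_cut (j b) (sigma (t b)) w.
  move=> dw; rewrite -(sideE b w dw).
  have [_ [_ [rhoc _]]] := comp (t' b).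
  have := rhoc b (inl (true, j' b)) w x dw dx.
  have := rhoc b (inl (false, j' b)) w x dw dx.
  rewrite !rho_pred_sub (side_eq maxD maxD' jd td dx dx') (sideE' b x dx').
  move=> [_ E1] [_ E2]; apply/funext => u; apply/propext.
  by split; [apply: E1|apply: E2].
apply: nE; exists b, q, s => Hz; apply: bpz.
apply: near_sub (near_and Hz (opn z dz)) => w [rw dw].
by rewrite (rho_ext q _ (HE w dw)) (rho_ext q _ (HE z dz)).
Qed.

(** Open domains with the same left end have a common point near it, from which [dom_right] leads
    on; over common points the sides agree. *)
Lemma coded_inj c Delta Delta' : coded c Delta -> coded c Delta' ->
  forall x y, Delta x y -> Delta' x y.
Proof.
move=> [j [t [maxD [cE cD]]]] [j' [t' [maxD' [cE' cD']]]].
have [jd td] : j c.1.1 = j' c.1.1 /\ t c.1.1 = t' c.1.1.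
  by move: cE'; rewrite cE => -[].
have DE x y : dom Delta x -> dom Delta' x -> Delta x y -> Delta' x y.
  move=> dx dx'; case: (maxD) (maxD') => [_ _ _ E] [_ _ _ E'].
  move=> /E[_]; rewrite !(side_eq maxD maxD' jd td dx dx') => HH.
  by apply/E'; split.
suff sub_dom x : dom Delta x -> dom Delta' x.
  move=> x y Dxy; have dx : dom Delta x by exists y.
  by apply: DE => //; apply: sub_dom.
have [[[u du] _] _] : compatible Delta (sigma (t true)) by case: maxD.
have [[[u' du'] _] _] : compatible Delta' (sigma (t' true)) by case: maxD'.
move: cD cD'; case: c.2 => [[[[q i] s] o]|].
  move=> [z [zi Hz]] [z' [/(nth_pt_uniq zi) <-]].
  case: o Hz => [[opn [zD left]] [opn' [zD' left']] dx|Hz Hz' /Hz dx]; last exact/Hz'.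
  have [w [zw [wu wu']]] := between_min (zD u du) (zD' u' du').
  have dw : dom Delta w by apply: left du zw _; order.
  have dw' : dom Delta' w by apply: left' du' zw _; order.
  case: (lt_total w x) => [wx|[<-//|xw]].
    exact: dom_right maxD maxD' jd td opn dw dw' dx wx.
  by apply: left' dw' (zD x dx) _; order.
move=> [opn left] [opn' left'] dx.
have [w [wu wu']] : exists w, w ≼ u /\ w ≼ u'.
  case: (lt_leP u u') => [lt|le]; first by exists u; split; order.
  by exists u'; split=> //; apply: lt_irr.
have dw : dom Delta w by apply: left du _.
have dw' : dom Delta' w by apply: left' du' _.
case: (lt_total w x) => [wx|[<-//|xw]].
  exact: dom_right maxD maxD' jd td opn dw dw' dx wx.
by apply: left' dw' _; order.
Qed.

Lemma card_code : 0 < #|T| ->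
  #|code| <= 2 * #|curve_type| * (#|event_type| * max_events.+1 * 2).+1 * #|T| ^ 2.
Proof.
move=> T0; rewrite !card_prod card_option !card_prod card_bool card_ord.
rewrite -mulnn (mulnA 2) mulnACA; apply: leq_mul => //.
by rewrite mulSn -addn1 addnC leq_add // mulnAC leqnn.
Qed.

End Counting.

End Cells.

(** * The distal cell decomposition *)

Local Open Scope classical_set_scope.
Local Open Scope card_scope.

Section Decomposition.
Variables (L : language) (R : rcfType) (M : structure L R).
Hypotheses (hfield : expands_ordered_field M) (homin : o_minimal M).
Variables (n : nat) (phi : formula L ('I_2 + 'I_n)).

Let S : dstr := reals hfield.

Definition point (W : Type) (x y : W) : {ffun 'I_2 -> W} :=
  [ffun i => if i == ord0 then x else y].

Lemma pointE (W : Type) (p : {ffun 'I_2 -> W}) : point (p ord0) (p ord_max) = p.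
Proof.
apply/ffunP => i; rewrite ffunE; case: eqP => [->//|/eqP i0].
by congr (p _); apply/val_inj; case: i i0 => [[|[]]].
Qed.

Definition rphi (s : 'I_n -> S) (x y : S) : Prop := defset M phi s (point x y).

Lemma D_rphi (W : finType) (r : 'I_n -> W) a b :
  D (fun e : W -> S => rphi (fun v => e (r v)) (e a) (e b)).
Proof.
exists (fren (fun v => match v with inl i => point a b i | inr w => r w end) phi).
move=> e; rewrite holds_fren /rphi /defset /=.
rewrite (_ : (fun v => _) = (fun v => e (match v with
  | inl i => point a b i | inr w => r w end))) //.
by apply/funext => -[i|w] //; rewrite !ffunE; case: ifP.
Qed.

Let ufin (W : finType) (P : (option W -> S) -> Prop) : D P ->
  exists N, forall e : W -> S, card_le N (bp (fun x => P (oapp e x))).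
Proof. exact: fdef_uniform_finiteness. Qed.

Let sep (W : finType) (P : (option W -> S) -> Prop) : D P -> forall e : W -> S,
  separates (bp (fun x => P (oapp e x))) (fun x => P (oapp e x)).
Proof. exact: fdef_separates. Qed.

Notation curves := (curve_type D_rphi ufin).
Notation base_cuts := (base_cut_type D_rphi ufin).

(** Finite functions keep the index type finite, so that the formulas psi can be numbered. *)
Definition index : finType := ({ffun bool -> curves} * {ffun bool -> base_cuts})%type.

(* The four parameters of a cell, indexed by [bool * bool]: [(false, b)] is the
   parameter of the curve on side [b], and [(true, b)] that of the event
   which bounds the domain on side [b]. *)
Definition arity := #|{: bool * bool}|.
Definition param (c b : bool) : 'I_arity := enum_rank (c, b).

Definition icell (x : index) (s : 'I_arity -> {ffun 'I_n -> R}) : S -> S -> Prop :=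
  cell (S := S) (x.1 : bool -> curves) (x.2 : bool -> base_cuts)
    (fun b => s (param false b)) (fun b => s (param true b)).

Lemma psi_ex (x : index) : exists f : formula L ('I_2 + 'I_arity * 'I_n),
  forall s p, defset M f (tuple_env s) p <-> icell x s (p ord0) (p ord_max).
Proof.
have [f Ef] := D_cell (S := S) (x.1 : bool -> curves) (x.2 : bool -> base_cuts)
  (fun b v => inr (param false b, v) : 'I_2 + 'I_arity * 'I_n)
  (fun b v => inr (param true b, v)) (inl ord0) (inl ord_max).
exists f => s p; rewrite /defset /=.
exact: (iff_sym (Ef (fun v => match v with inl i => p i | inr w => tuple_env s w end))).
Qed.

Notation comp := (compatible (S := S) D_rphi ufin).

Lemma theta_ex (x : index) : exists f : formula L ('I_n + 'I_arity * 'I_n),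
  forall s y, defset M f (tuple_env s) y <-> ~ comp (icell x s) y.
Proof.
have [|f Ef] := D_compatible (S := S) (W := ('I_n + 'I_arity * 'I_n)%type)
  D_rphi ufin (Delta := fun e => cell (S := S) (x.1 : bool -> curves) (x.2 : bool -> base_cuts)
    (fun b v => e (inr (param false b, v))) (fun b v => e (inr (param true b, v))))
  inl.
  move=> W r a b; exact: (D_cell (S := S) _ _ (fun b v => r (inr (param false b, v)))
    (fun b v => r (inr (param true b, v)))).
exists (Not f) => s y; rewrite /defset /=.
have := Ef (fun v => match v with inl i => y i | inr w => tuple_env s w end).
by move=> E; split=> nH Hc; apply: nH; apply/E.
Qed.

Definition region (D : set {ffun 'I_2 -> R}) (x y : S) : Prop := D (point x y).

(** This is the function I, given by D alone; [theta] expresses it through the parameters. *)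
Definition conflict (D : set {ffun 'I_2 -> R}) : set {ffun 'I_n -> R} :=
  [set s | ~ comp (region D) s]%classic.

Definition psi (i : 'I_#|index|) := sval (cid (psi_ex (enum_val i))).
Definition theta (i : 'I_#|index|) := sval (cid (theta_ex (enum_val i))).

Lemma psiP i s p :
  defset M (psi i) (tuple_env s) p <-> icell (enum_val i) s (p ord0) (p ord_max).
Proof. by rewrite /psi; case: cid. Qed.

Lemma thetaP i s y :
  defset M (theta i) (tuple_env s) y <-> ~ comp (icell (enum_val i) s) y.
Proof. by rewrite /theta; case: cid. Qed.

Lemma region_psi i s : region (defset M (psi i) (tuple_env s)) = icell (enum_val i) s.
Proof.
apply/funext => x; apply/funext => y; apply/propext.
by rewrite /region psiP !ffunE.
Qed.

Definition decomposition (A : {fset {ffun 'I_n -> R}}) : set (set {ffun 'I_2 -> R}) :=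
  [set D | instances M psi A D /\ conflict D `&` [set` A] = set0]%classic.

Definition elt (A : {fset {ffun 'I_n -> R}}) (t : A) : 'I_n -> S := val t : {ffun _ -> _}.
Arguments elt : clear implicits.

Lemma decompositionP A D : decomposition A D <->
  exists (x : index) (t t2 : bool -> A),
    region D = cell (S := S) (x.1 : bool -> curves) (x.2 : bool -> base_cuts)
      (fun b => elt A (t b)) (fun b => elt A (t2 b)) /\
    forall t', comp (region D) (elt A t').
Proof.
split=> [[[i [s [sA ->]]] free]|[x [t [t2 [DE compD]]]]].
  exists (enum_val i), (fun b => [` sA (param false b)]%fset),
    (fun b => [` sA (param true b)]%fset); split; first by rewrite region_psi.
  move=> t'; apply: contrapT => nc.
  suff : set0 (val t') by [].
  by rewrite -free; split=> //=; apply: valP.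
split; last first.
  rewrite -subset0 => s [/= nc sA]; apply: nc.
  exact: (compD [` sA]%fset).
pose s (k : 'I_arity) : {ffun 'I_n -> R} :=
  let: (c, b) := enum_val k in if c then val (t2 b) else val (t b).
exists (enum_rank x), s; split.
  by move=> k; rewrite /s; case: enum_val => -[] b; apply: valP.
apply/funext => p; apply/propext; rewrite psiP enum_rankK.
suff -> : icell x s = region D by rewrite /region pointE.
rewrite DE /icell; congr (cell (S := S) _ _ _ _).
  by apply/funext => b; rewrite /s enum_rankK.
by apply/funext => b; rewrite /s enum_rankK.
Qed.

Lemma decomposition_covers A : A != fset0 ->
  \bigcup_(D in decomposition A) D = setT.
Proof.
move=> /fset0Pn[s0 s0A]; rewrite -subTset => p _.
have [j [g [t [t2 [pD compD]]]]] :=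
  cells_cover D_rphi ufin sep (elt A) [` s0A]%fset (p ord0) (p ord_max).
pose Delta := cell j g (fun b => elt A (t b)) (fun b => elt A (t2 b)).
pose Dp : set {ffun 'I_2 -> R} := fun q => Delta (q ord0) (q ord_max).
have DpE : region Dp = Delta.
  apply/funext => x; apply/funext => y.
  by rewrite /region /Dp /point !ffunE.
exists Dp => //; apply/decompositionP.
exists ([ffun b => j b], [ffun b => g b]), t, t2; rewrite DpE; split=> //.
rewrite /Delta; congr (cell (S := S) _ _ _ _);
  by apply/funext => b; rewrite ffunE.
Qed.

Lemma decomposition_uncrossed A D s :
  decomposition A D -> s \in A -> ~ crosses (defset M phi s) D.
Proof.
move=> /decompositionP[x [t [t2 [_ compD]]]] sA [[p [Dp phip]] [q [Dq nphiq]]].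
apply: nphiq; have := compatible_uncrossed sep (compD [` sA]%fset)
  (x := p ord0) (y := p ord_max) (x' := q ord0) (y' := q ord_max).
by rewrite /region /rphi !pointE; apply.
Qed.

Lemma decomposition_card A :
  decomposition A #<= `I_(#|code D_rphi ufin A|).
Proof.
pose is_coded k D := decomposition A D /\ exists c : code D_rphi ufin A,
  enum_rank c = k :> nat /\ coded (elt A) c (region D).
(* F decodes; numbers that code no cell are sent to the empty set. *)
pose F k := if pselect (exists D, is_coded k D) is left ex then sval (cid ex)
            else set0.
apply: (card_le_trans (B := F @` _) _ (card_image_le F _)).
apply: subset_card_le => D dD.
have [x [t [t2 [DE compD]]]] := (decompositionP A D).1 dD.
have [c cD] : exists c : code D_rphi ufin A, coded (elt A) c (region D).
  by rewrite DE in compD *; apply: coded_ex.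
exists (enum_rank c) => //=; rewrite /F; case: pselect => [ex|nex]; last first.
  by case: nex; exists D; split=> //; exists c.
case: (cid ex) => D' /= [dD' [c' [/val_inj/enum_rank_inj cE cD']]].
rewrite {}cE in cD'.
apply/funext => p; apply/propext; rewrite -(pointE p).
split; first exact: (coded_inj cD' cD).
exact: (coded_inj cD cD').
Qed.

Lemma decomposition_bound : exists C, forall A, A != fset0 ->
  decomposition A #<= `I_(C * #|` A| ^ 2)%N.
Proof.
exists (2 * #|curves| * (#|event_type D_rphi ufin| * (max_events D_rphi ufin).+1 * 2).+1).
move=> A /fset0Pn[s sA]; apply: card_le_trans (decomposition_card A) _.
rewrite card_le_II cardfE; apply: card_code.
by apply/card_gt0P; exists [` sA]%fset.
Qed.

End Decomposition.

Theorem theorem4p1 (L : language) (R : rcfType) (M : structure L R)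
    (hfield : expands_ordered_field M) (homin : o_minimal M)
    (n : nat) (phi : formula L ('I_2 + 'I_n)) :
  exists T : {fset {ffun 'I_n -> R}} -> set (set {ffun 'I_2 -> R}),
    distal_cell_decomposition M phi T /\
    exists C : nat, forall S : {fset {ffun 'I_n -> R}}, S != fset0 ->
      T S #<= `I_(C * #|` S| ^ 2)%N.
Proof.
exists (decomposition hfield homin phi); split.
  split; first exact: decomposition_covers.
  split; first by move=> A D s; apply: decomposition_uncrossed.
  exists arity, _, (@psi _ _ _ hfield homin _ phi), (@theta _ _ _ hfield homin _ phi).
  exists (conflict hfield homin phi); split=> // i s.
  apply/funext => y; apply/propext; rewrite thetaP.
  by rewrite /conflict /= region_psi.
exact: decomposition_bound.
Qed.
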